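(* Consider the hybrid system with state $q=(x,e,\kappa,\eta)\in\mathbb{R}^{n_x}\times\mathbb{R}^{n_e}\times\mathbb{Z}_{\ge 0}\times\mathbb{R}$ $$\dot x=f_x(x,e),\quad \dot e=f_e(x,e),\quad \dot\kappa=0,\quad \dot\eta=-\delta(\eta)\qquad\text{for } q\in C,$$ $$x^+=x,\quad e^+=h_e(\kappa,e),\quad \kappa^+=\kappa+1,\quad \eta^+=\tilde\gamma(W(\kappa,e))\qquad\text{for } q\in D,$$ with $$C=\{q:\max\{V(x),\eta\}\ge\tilde\gamma(W(\kappa,e))\text{ and }\eta\ge 0\},\qquad D=\{q:\max\{V(x),\eta\}\le\tilde\gamma(W(\kappa,e))\text{ and }\eta\ge 0\},$$ where $\delta$ is a locally Lipschitz class-$\mathcal{K}_\infty$ function, the functions $f_x,f_e,h_e$ are those of the networked control system described in the context, and $V$, $W$, $\tilde\gamma$ are as follows. Suppose that: (i) (Input-to-state stability) There exist a smooth function $V:\mathbb{R}^{n_x}\to\mathbb{R}$ and $\underline\alpha_V,\overline\alpha_V,\alpha,\gamma\in\mathcal{K}_\infty$ such that $\underline\alpha_V(|x|)\le V(x)\le\overline\alpha_V(|x|)$ for all $x\in\mathbb{R}^{n_x}$ and $\langle\nabla V(x),f_x(x,e)\rangle\le-\alpha(V(x))+\gamma(|e|)$ for all $(x,e)\in\mathbb{R}^{n_x+n_e}$. (Uniformly globally asymptotically stable protocol) There exist $W:\mathbb{R}_{\ge0}\times\mathbb{R}^{n_e}\to\mathbb{R}_{\ge 0}$, $\underline\alpha_W,\overline\alpha_W\in\mathcal{K}_\infty$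 and $\rho\in[0,1)$ such that for all $(\kappa,e)\in\mathbb{Z}_{\ge 0}\times\mathbb{R}^{n_e}$: $\underline\alpha_W(|e|)\le W(\kappa,e)\le\overline\alpha_W(|e|)$ and $W(\kappa+1,h_e(\kappa,e))\le\rho W(\kappa,e)$. The function $\tilde\gamma$ is $\tilde\gamma=\alpha^{-1}\circ\sigma^{-1}\circ\gamma\circ\underline\alpha_W^{-1}$, where $\sigma\in\mathcal{K}_\infty$ is any function with $\sigma(s)<s$ for all $s>0$. (ii) The function $(\kappa,e)\mapsto\tilde\gamma(W(\kappa,e))$ is locally Lipschitz in $e$. (iii) For any compact set $S\subset\mathbb{R}^{n_x+n_e}$ there exist $L_1,L_2\in\mathbb{R}_{\ge0}$ such that for all $(x,e)\in S$ and all $\kappa\in\mathbb{Z}_{\ge 0}$, $$|\langle\nabla V(x),f_x(x,e)\rangle|\le L_1\big(V(x)+\tilde\gamma(W(\kappa,e))\big),\qquad |\tilde\gamma(W)^\circ(e;f_e(x,e))|\le L_2\big(V(x)+\tilde\gamma(W(\kappa,e))\big),$$ where $\tilde\gamma(W)^\circ(e;v)$ is the Clarke generalized directional derivative of $e\mapsto\tilde\gamma(W(\kappa,e))$ (with $\kappa$ fixed) at $e$ in direction $v$. (iv) There exists $\epsilon\in[0,1)$ such that $\lim_{s\to0}\frac{\tilde\gamma(\rho s)}{\tilde\gamma(s)}=\epsilon$. Then the set $\mathcal{A}=\{q:(x,e,\eta)=0\}$ is S-GAS for this hybrid system, and the solutions of this system have a semiglobal dwell time on $\mathbb{R}^{n_q}\setminus\mathcal{A}$,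 where $n_q=n_x+n_e+2$.
   Context: Hybrid systems. Solutions $\phi$ of a hybrid system $\dot q=f_q(q)$, $q\in C$; $q^+=h_q(q)$, $q\in D$ are hybrid arcs in the sense of Goebel and Teel: $\phi$ is defined on a hybrid time domain $\operatorname{dom}\phi\subset\mathbb{R}_{\ge 0}\times\mathbb{Z}_{\ge 0}$, is locally absolutely continuous in $t$ for each fixed $j$, satisfies $\phi(t,j)\in C$ and $\dot\phi(t,j)=f_q(\phi(t,j))$ during flows (for almost all $t$ for the differential equation), and satisfies $\phi(t,j)\in D$, $\phi(t,j+1)=h_q(\phi(t,j))$ whenever $(t,j),(t,j+1)\in\operatorname{dom}\phi$; $\phi(0,0)\in C\cup D$. On $C\cap D$ a solution may jump, or flow if flowing keeps it in $C$. Comparison functions. $\mathcal{K}_\infty$: continuous, strictly increasing, unbounded functions $\mathbb{R}_{\ge0}\to\mathbb{R}_{\ge0}$ vanishing at $0$. $\beta:\mathbb{R}_{\ge0}^3\to\mathbb{R}_{\ge0}$ is of class $\mathcal{KLL}$ if $\beta(\cdot,\cdot,r)\in\mathcal{KL}$ and $\beta(\cdot,r,\cdot)\in\mathcal{KL}$ for every $r\ge0$. $|q|_{\mathcal{A}}$ is the distance from $q$ to $\mathcal{A}$; here $|q|_{\mathcal A}=|(x,e,\eta)|$. S-GAS. A closed set $\mathcal{A}$ is S-GAS if for every $\Delta>0$ there is $\beta_\Delta\in\mathcal{KLL}$ such that every solution $\phi$ with $|\phi(0,0)|_{\mathcal{A}}<\Delta$ satisfies $|\phi(t,j)|_{\mathcal{A}}\le\beta_\Delta(|\phi(0,0)|_{\mathcal{A}},t,j)$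 for all $(t,j)\in\operatorname{dom}\phi$. Semiglobal dwell time on $\mathbb{R}^{n_q}\setminus\mathcal{A}$. For every $\Delta>0$ there is $\tau(\Delta)>0$ such that, for every solution $\phi$ with $|\phi(0,0)|_{\mathcal{A}}<\Delta$, any two successive jumps are separated by at least $\tau(\Delta)$ units of time as long as the solution is outside $\mathcal{A}$; that is, for all $(s,i),(t,j)\in\operatorname{dom}\phi$ with $s\le t$, $i\le j$ and such that $\phi(t',j')\notin\mathcal{A}$ for all $(t',j')\in\operatorname{dom}\phi$ with $s\le t'\le t$, $i\le j'\le j$, one has $j-i\le\frac{t-s}{\tau(\Delta)}+1$. Clarke derivative. For $U$ locally Lipschitz, $U^\circ(z;v)=\limsup_{y\to z,\,h\to0^+}\frac{U(y+hv)-U(y)}{h}$. Networked control system. The plant is $\dot x_P=f_P(x_P,\hat u)$ with state $x_P\in\mathbb{R}^{n_P}$, the controller is $\dot x_C=f_C(x_C,\hat x_P)$, $u=g_C(x_C,\hat x_P)$ with $x_C\in\mathbb{R}^{n_C}$, $u\in\mathbb{R}^{n_u}$. Between transmissions the networked values evolve by $\dot{\hat x}_P=\hat f_P(x_P,x_C,\hat x_P,\hat u)$, $\dot{\hat u}=\hat f_C(x_P,x_C,\hat x_P,\hat u)$. Set $x=(x_P,x_C)\in\mathbb{R}^{n_x}$ and $e=(e_{x_P},e_u)=(\hat x_P-x_P,\hat u-u)\in\mathbb{R}^{n_e}$. With $\hat x_P=x_P+e_{x_P}$ and $\hat u=g_C(x_C,\hat x_P)+e_u$, $$f_x(x,e)=\begin{pmatrix}f_P(x_P,\hat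 u)\\ f_C(x_C,\hat x_P)\end{pmatrix},\qquad f_e(x,e)=\begin{pmatrix}\hat f_P(x_P,x_C,\hat x_P,\hat u)-f_P(x_P,\hat u)\\ \hat f_C(x_P,x_C,\hat x_P,\hat u)-\frac{\partial g_C}{\partial x_C}(x_C,\hat x_P)f_C(x_C,\hat x_P)-\frac{\partial g_C}{\partial\hat x_P}(x_C,\hat x_P)\hat f_P(x_P,x_C,\hat x_P,\hat u)\end{pmatrix}.$$ Standing assumptions: $f_x$ and $f_e$, as well as the flow and jump maps of $\eta$, are continuous; the sets $C$ and $D$ are closed. The map $h_e:\mathbb{Z}_{\ge0}\times\mathbb{R}^{n_e}\to\mathbb{R}^{n_e}$ (the protocol) describes which part of the error is updated at a transmission; it is not assumed continuous. $\kappa$ is a counter of transmissions with values in $\mathbb{Z}_{\ge0}$. *)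

(* Defs.v *)
From HB Require Import structures.
From mathcomp Require Import all_boot all_order all_algebra.
From mathcomp Require Import all_classical all_reals all_analysis.
Set Implicit Arguments.
Unset Strict Implicit.
Unset Printing Implicit Defensive.
Import Order.TTheory GRing.Theory Num.Theory.
Import numFieldNormedType.Exports.
Local Open Scope classical_set_scope.
Local Open Scope ring_scope.

Section RealFunctions.
Context {R : realType}.
Implicit Types f g : R -> R.

Definition nonneg : set R := [set s | 0 <= s].

(* Functions on [0, +oo[ are encoded as total functions R -> R; their values on
   negative arguments are never constrained. *)
Definition class_K f :=
  [/\ {within nonneg, continuous f}, f 0 = 0
    & forall s t, 0 <= s -> s < t -> f s < f t].

Definition class_Koo f := class_K f /\ forall M, exists2 s, 0 <= s & M < f s.

Definition inv_nonneg f : R -> R := 'pinv_(fun=> 0) nonneg f.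

Definition class_KL (b : R -> R -> R) :=
  [/\ {within [set p : R * R | 0 <= p.1 /\ 0 <= p.2],
        continuous (fun p : R * R => b p.1 p.2)},
      forall t, 0 <= t -> class_K (fun s => b s t)
    & forall s, 0 <= s ->
        (forall t t', 0 <= t -> t <= t' -> b s t' <= b s t) /\
        b s t @[t --> +oo] --> (0 : R)].

Definition class_KLL (b : R -> R -> R -> R) :=
  forall r, 0 <= r ->
    class_KL (fun s t => b s t r) /\ class_KL (fun s j => b s r j).

Definition locally_lipschitz_on (U V : normedModType R) (A : set U)
    (f : U -> V) :=
  forall z, A z -> exists k : R, exists2 B, nbhs z B & k.-lipschitz_(A `&` B) f.

Definition abs_continuous (V : normedModType R) (a b : R) (g : R -> V) :=
  forall eps, 0 < eps -> exists2 d, 0 < d &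
    forall m (u v : 'I_m -> R),
      (forall i, [/\ a <= u i, u i <= v i & v i <= b]) ->
      trivIset setT (fun i => `]u i, v i[%classic) ->
      \sum_i (v i - u i) < d ->
      \sum_i `|g (v i) - g (u i)| < eps.

Definition locally_abs_continuous (V : normedModType R) (I : set R)
    (g : R -> V) :=
  forall a b, a <= b -> `[a, b]%classic `<=` I -> abs_continuous a b g.

End RealFunctions.

Section EuclideanSpace.
Context {R : realType} {n : nat}.
Implicit Types u v z : 'rV[R]_n.

Definition dot u v : R := \sum_i u 0 i * v 0 i.

(* The library norm on matrices is the max norm. *)
Definition enorm u : R := Num.sqrt (dot u u).

Definition grad (f : 'rV[R]_n -> R) z : 'rV[R]_n :=
  \row_i 'D_(delta_mx 0 i) f z.

(* All iterated partial derivatives exist and are differentiable. *)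
Definition smooth (f : 'rV[R]_n -> R) :=
  forall (s : seq 'I_n) z,
    differentiable (foldr (fun i g => 'D_(delta_mx 0 i) g) f s) z.

Definition clarke (U : 'rV[R]_n -> R) z v : \bar R :=
  limf_esup
    (fun p : 'rV[R]_n * R => ((U (p.1 + p.2 *: v) - U p.1) / p.2)%:E)
    (filter_prod (nbhs z) (0 : R)^'+).

End EuclideanSpace.

Section HybridSystems.
Context {R : realType}.

(* The state space is a subset of R^n, presented as a type embedded in R^n by
   [coords]; this lets some coordinates be integer-valued. *)
Record hybrid_system (n : nat) := HybridSystem {
  state : Type;
  coords : state -> 'rV[R]_n;
  coords_inj : injective coords;
  flow_set : set state;
  jump_set : set state;
  flow_map : state -> 'rV[R]_n;
  jump_map : state -> state }.

#[global] Arguments coords {n} h _.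
#[global] Arguments flow_set {n} h _.
#[global] Arguments jump_set {n} h _.
#[global] Arguments flow_map {n} h _.
#[global] Arguments jump_map {n} h _.

Definition compact_hybrid_time_domain (E : set (R * nat)) :=
  exists J (tj : nat -> R),
    [/\ tj 0 = 0, forall j, (j <= J)%N -> tj j <= tj j.+1
      & E = [set p | (p.2 <= J)%N /\ tj p.2 <= p.1 <= tj p.2.+1]].

Definition hybrid_time_domain (E : set (R * nat)) :=
  (forall t j, E (t, j) -> 0 <= t) /\
  forall T J, E (T, J) ->
    compact_hybrid_time_domain
      (E `&` [set p | 0 <= p.1 <= T /\ (p.2 <= J)%N]).

Context {n : nat} (H : hybrid_system n).

(* An arc is a total function, of which only the values on [dom] matter. *)
Record is_solution (dom : set (R * nat)) (phi : R -> nat -> state H) : Prop := {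
  sol_domain : hybrid_time_domain dom;
  sol_init : dom (0, 0%N) /\ (flow_set H `|` jump_set H) (phi 0 0%N);
  sol_abs_continuous : forall j,
    locally_abs_continuous [set t | dom (t, j)]
      (fun t => coords H (phi t j));
  sol_flow_set : forall j t, ([set s | dom (s, j)])° t -> flow_set H (phi t j);
  sol_flow : forall j,
    {ae @lebesgue_measure R, forall t, ([set s | dom (s, j)])° t ->
      is_derive t 1 (fun s => coords H (phi s j)) (flow_map H (phi t j))};
  sol_jump : forall t j, dom (t, j) -> dom (t, j.+1) ->
    jump_set H (phi t j) /\ phi t j.+1 = jump_map H (phi t j) }.

Definition set_dist (A : set (state H)) (q : state H) : R :=
  inf [set enorm (coords H q - coords H a) | a in A].

Definition SGAS (A : set (state H)) :=
  closed (coords H @` A) /\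
  forall Delta, 0 < Delta -> exists2 beta : R -> R -> R -> R, class_KLL beta &
    forall dom phi, is_solution dom phi ->
      set_dist A (phi 0 0%N) < Delta ->
      forall t j, dom (t, j) ->
        set_dist A (phi t j) <= beta (set_dist A (phi 0 0%N)) t j%:R.

Definition semiglobal_dwell_time_outside (A : set (state H)) :=
  forall Delta, 0 < Delta -> exists2 tau : R, 0 < tau &
    forall dom phi, is_solution dom phi ->
      set_dist A (phi 0 0%N) < Delta ->
      forall s i t j, dom (s, i) -> dom (t, j) -> s <= t -> (i <= j)%N ->
        (forall t' j', dom (t', j') -> s <= t' <= t -> (i <= j' <= j)%N ->
          ~ A (phi t' j')) ->
        j%:R - i%:R <= (t - s) / tau + 1.

End HybridSystems.

Section NetworkedControlSystems.
Context {R : realType} {nP nC nu : nat}.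

(* x = (x_P, x_C), e = (e_{x_P}, e_u) *)
Local Notation nx := (nP + nC)%N.
Local Notation ne := (nP + nu)%N.

Record ncs := NCS {
  fP : 'rV[R]_nP -> 'rV[R]_nu -> 'rV[R]_nP;
  fC : 'rV[R]_nC -> 'rV[R]_nP -> 'rV[R]_nC;
  gC : 'rV[R]_nC -> 'rV[R]_nP -> 'rV[R]_nu;
  fPhat : 'rV[R]_nP -> 'rV[R]_nC -> 'rV[R]_nP -> 'rV[R]_nu -> 'rV[R]_nP;
  fChat : 'rV[R]_nP -> 'rV[R]_nC -> 'rV[R]_nP -> 'rV[R]_nu -> 'rV[R]_nu;
  he : nat -> 'rV[R]_ne -> 'rV[R]_ne }.

Variable S : ncs.

Definition partially_differentiable_gC :=
  forall xC xP,
    differentiable (fun y => gC S y xP) xC /\ differentiable (gC S xC) xP.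

Definition xPhat (x : 'rV[R]_nx) (e : 'rV[R]_ne) : 'rV[R]_nP :=
  lsubmx x + lsubmx e.

Definition uhat (x : 'rV[R]_nx) (e : 'rV[R]_ne) : 'rV[R]_nu :=
  gC S (rsubmx x) (xPhat x e) + rsubmx e.

Definition fx (x : 'rV[R]_nx) (e : 'rV[R]_ne) : 'rV[R]_nx :=
  row_mx (fP S (lsubmx x) (uhat x e)) (fC S (rsubmx x) (xPhat x e)).

(* Row-vector convention: the product of a Jacobian with a vector v is
   v *m 'J g p. *)
Definition fe (x : 'rV[R]_nx) (e : 'rV[R]_ne) : 'rV[R]_ne :=
  let xP := lsubmx x in
  let xC := rsubmx x in
  let xh := xPhat x e in
  let uh := uhat x e in
  row_mx
    (fPhat S xP xC xh uh - fP S xP uh)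
    (fChat S xP xC xh uh
     - fC S xC xh *m 'J (fun y : 'rV[R]_nC => gC S y xh) xC
     - fPhat S xP xC xh uh *m 'J (gC S xC) xh).

Record ncs_state := NCSState {
  q_x : 'rV[R]_nx; q_e : 'rV[R]_ne; q_kappa : nat; q_eta : R }.

Definition ncs_coords (q : ncs_state) : 'rV[R]_(nx + ne + 2) :=
  row_mx (row_mx (q_x q) (q_e q)) (row_mx ((q_kappa q)%:R%:M) ((q_eta q)%:M)).

Lemma ncs_coords_inj : injective ncs_coords.
Proof.
move=> [x e k t] [x' e' k' t'] /eq_row_mx[/eq_row_mx[/= -> ->]].
have M0 (c c' : R) : c%:M = c'%:M :> 'M[R]_1 -> c = c'.
  by move=> /(congr1 (fun M : 'M[R]_1 => M 0 0)); rewrite !mxE !eqxx !mulr1n.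
by move=> /(@eq_row_mx _ _ 1 1)[/M0/eqP + /M0 ->]; rewrite eqr_nat => /eqP ->.
Qed.

Variables (delta gtilde : R -> R) (V : 'rV[R]_nx -> R) (W : R -> 'rV[R]_ne -> R).

Definition gtildeW (k : nat) (e : 'rV[R]_ne) : R := gtilde (W k%:R e).

Definition ncs_flow_set : set ncs_state := [set q |
  gtildeW (q_kappa q) (q_e q) <= Num.max (V (q_x q)) (q_eta q) /\ 0 <= q_eta q].

Definition ncs_jump_set : set ncs_state := [set q |
  Num.max (V (q_x q)) (q_eta q) <= gtildeW (q_kappa q) (q_e q) /\ 0 <= q_eta q].

Definition ncs_flow_map (q : ncs_state) : 'rV[R]_(nx + ne + 2) :=
  row_mx (row_mx (fx (q_x q) (q_e q)) (fe (q_x q) (q_e q)))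
         (row_mx (0 : 'rV[R]_1) ((- delta (q_eta q))%:M)).

Definition ncs_jump_map (q : ncs_state) : ncs_state :=
  NCSState (q_x q) (he S (q_kappa q) (q_e q)) (q_kappa q).+1
           (gtildeW (q_kappa q) (q_e q)).

Definition ncs_system : hybrid_system (nx + ne + 2) :=
  HybridSystem ncs_coords_inj ncs_flow_set ncs_jump_set
    ncs_flow_map ncs_jump_map.

Definition target : set (state ncs_system) :=
  [set q : ncs_state | [/\ q_x q = 0, q_e q = 0 & q_eta q = 0]].

Lemma set_dist_target (q : ncs_state) :
  set_dist target q = enorm (row_mx (row_mx (q_x q) (q_e q)) (q_eta q)%:M).
Proof.
have dotE m (u : 'rV[R]_m) : 0 <= dot u u.
  by apply: sumr_ge0 => i _; rewrite -expr2 sqr_ge0.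
have dot_row m p (u : 'rV[R]_m) (v : 'rV[R]_p) :
    dot (row_mx u v) (row_mx u v) = dot u u + dot v v.
  rewrite /dot big_split_ord /=; congr (_ + _).
    by apply: eq_bigr => i _; rewrite row_mxEl.
  by apply: eq_bigr => i _; rewrite row_mxEr.
set r := RHS.
have lb a : target a -> r <= enorm (coords ncs_system q - coords ncs_system a).
  case: a => x e k t [/= -> -> ->].
  rewrite /r /enorm ler_wsqrtr// /ncs_coords /= (opp_row_mx (row_mx _ _)).
  rewrite (@opp_row_mx _ 1 1 1) add_row_mx (@add_row_mx _ 1 1 1) opp_row_mx.
  rewrite add_row_mx !oppr0 !addr0 !dot_row (@dot_row 1 1) lerD2l.
  have -> : - (0 : R)%:M = 0 :> 'M[R]_1 by rewrite raddf0 oppr0.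
  by rewrite addr0 lerDr.
pose a0 : ncs_state := NCSState 0 0 (q_kappa q) 0.
have ta0 : target a0 by [].
have da0 : enorm (coords ncs_system q - coords ncs_system a0) = r.
  rewrite /r /enorm /ncs_coords /= (opp_row_mx (row_mx _ _)).
  rewrite (@opp_row_mx _ 1 1 1) add_row_mx (@add_row_mx _ 1 1 1) opp_row_mx.
  rewrite add_row_mx !oppr0 !addr0 !dot_row (@dot_row 1 1) subrr.
  have -> : - (0 : R)%:M = 0 :> 'M[R]_1 by rewrite raddf0 oppr0.
  by rewrite addr0 [dot 0 0]big1 ?add0r// => i _; rewrite mxE mul0r.
apply/eqP; rewrite eq_le; apply/andP; split.
  rewrite -da0; apply: ge_inf; last by exists a0.
  by exists r => _ [a /lb + <-].
apply: lb_le_inf; first by exists r, a0.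
by move=> _ [a /lb + <-].
Qed.

End NetworkedControlSystems.

Arguments ncs : clear implicits.
Arguments ncs_state : clear implicits.
Arguments target {R nP nC nu} S delta gtilde V W _.

(* Main.v *)
(* The energy max(V(x), eta, gamma~(W)) is unchanged by jumps, and along flows,
   where it equals max(V(x), eta), it decreases at a rate bounded below by a
   positive definite function of itself. Stability in t follows by replacing
   that rate with a nondecreasing Lipschitz minorant c: the energy U then
   satisfies U(t) + t c(U(t)) <= U(0), an inequality that can be solved for U(t)
   explicitly. Decay in j comes from the dwell time: a jump resets eta to the old
   value g of gamma~(W), leaves V <= g, and contracts gamma~(W) below r g with
   r < 1 by the limit assumption. Until the next jump both quantities move at
   speed at most proportional to g, whence a gap independent of g. The bound on
   the Clarke derivative enters only here.

   Solutions satisfy the differential equation almost everywhere only, but f_x,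
   f_e and delta are continuous, so each flow is in fact C^1; this reduces all
   later estimates to pointwise ones and avoids any absolute continuity of
   V(x(t)) or gamma~(W(k, e(t))). *)
Require Import Defs.
From HB Require Import structures.
From mathcomp Require Import all_boot all_order all_algebra.
From mathcomp Require Import all_classical all_reals all_analysis.
From mathcomp Require Import measurable_realfun ring lra.
Set Implicit Arguments.
Unset Strict Implicit.
Unset Printing Implicit Defensive.
Import Order.TTheory GRing.Theory Num.Theory.
Import numFieldNormedType.Exports.
Local Open Scope classical_set_scope.
Local Open Scope ring_scope.

(** * Straddled derivatives, Cousin's lemma and mean value inequalities *)

Section EpsilonDelta.
Context {R : realType}.

(** Semiglobality comes from confinement: with [M = energy_up Delta], a solution that starts within
    [Delta] of the target keeps its energy below [M], hence (x, e) in a compact set whatever the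
    counter does. The dwell time and the decay rate are both chosen on that sublevel set. The same
    monotonicity localizes further: after a jump the energy equals g, so V and gamma~(W) stay below
    g until the next jump, which makes every speed proportional to g.

    Maxima and Lipschitz compositions are not differentiable, so the estimates are phrased as upper
    bounds on slopes over intervals around a point.

    The KLL bound needs decay in t and in j at once. Outside the target, t dominates the mean of t
    and tau (j - 1), so the decay estimate in t holds with that mean as time, and the mean is
    unbounded in each variable separately. Once the target is reached, the energy stays 0 and any
    bound holds. *)

Lemma within_continuousP (U V : normedModType R) (A : set U) (f : U -> V) :
  {within A, continuous f} <->
  forall x, A x -> forall e, 0 < e -> exists2 d : R, 0 < d &
    forall y, A y -> `|y - x| < d -> `|f y - f x| < e.
Proof.
rewrite subspace_continuousP; split=> [cf x Ax e e0|cf x Ax].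
  have /cvgrPdist_lt/(_ e e0) := cf x Ax.
  rewrite near_withinE near_simpl => /nbhs_normP[d /= d0 dP].
  exists d => // y Ay yx; rewrite distrC; apply: (dP y) => //=.
  by rewrite distrC.
apply/cvgrPdist_lt => e e0; have [d d0 dP] := cf x Ax e e0.
rewrite near_withinE; apply/nbhs_normP; exists d => //= y yx Ay.
by rewrite distrC; apply: dP => //; rewrite distrC.
Qed.

(* Increments are taken between points on either side of [t], since this is how
   the tagged partitions of Cousin's lemma use derivatives; at the endpoints of
   [[a, b]] the notion is one-sided. *)
Definition straddle (V : normedModType R) (a b : R) (c : R -> V) (t : R)
    (v : V) :=
  forall eps, 0 < eps -> exists2 r : R, 0 < r &
    forall s u, a <= s -> s <= t -> t <= u -> u <= b -> u - s < r ->
    `|c u - c s - (u - s) *: v| <= eps * (u - s).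

(** An upper bound on slopes is all that a maximum of two functions or a Clarke derivative
    yields. *)
Definition straddle_le (a b : R) (g : R -> R) (t k : R) :=
  forall eps, 0 < eps -> exists2 r : R, 0 < r &
    forall s u, a <= s -> s <= t -> t <= u -> u <= b -> u - s < r ->
    g u - g s <= (k + eps) * (u - s).

Lemma straddle_straddle_le a b (g : R -> R) t k :
  straddle a b g t k -> straddle_le a b g t k.
Proof.
move=> h e e0; have [r r0 hr] := h e e0; exists r => // s u as_ st tu ub us.
have := ler_normlW (hr s u as_ st tu ub us).
by rewrite /GRing.scale/= => ?; lra.
Qed.

Lemma straddle_le_weaken a b (g : R -> R) t k k' :
  k <= k' -> straddle_le a b g t k -> straddle_le a b g t k'.
Proof.
move=> kk h e e0; have [r r0 hr] := h e e0; exists r => // s u as_ st tu ub us.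
by apply: le_trans (hr s u as_ st tu ub us) _; apply: ler_wpM2r; lra.
Qed.

Lemma straddle_sub (V : normedModType R) a b a' b' (c : R -> V) t v :
  a <= a' -> b' <= b -> straddle a b c t v -> straddle a' b' c t v.
Proof.
move=> aa bb h e e0; have [r r0 hr] := h e e0; exists r => // s u *.
by apply: hr => //; lra.
Qed.

Lemma subrB_shift (Z : zmodType) (A B C X Y : Z) :
  A - B - (X - Y) = (A - C - X) - (B - C - Y).
Proof.
by rewrite (opprB (B - C)) (opprB B) (addrC Y) addrACA subrKA opprB (addrC Y).
Qed.

(** The increment is split at [t]; since [s <= t <= u], the two errors [e * (u - t)] and
    [e * (t - s)] add up to [e * (u - s)]. *)
Lemma is_derive_straddle (V : normedModType R) a b (c : R -> V) (t : R) v :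
  is_derive t 1 c v -> straddle a b c t v.
Proof.
move=> [dc <-] e e0.
have /cvgrPdist_le/(_ e e0) : h^-1 *: (c (h + t) - c t) @[h --> 0^'] --> 'D_1 c t.
  move: dc => /cvg_ex[l hl].
  have <- : (fun h => h^-1 *: ((c \o shift t) (h *: 1) - c t)) =
    (fun h => h^-1 *: (c (h + t) - c t)).
    by apply/funext => h; rewrite /= /GRing.scale/= mulr1.
  by rewrite /derive (cvg_lim _ hl).
rewrite near_withinE near_simpl => /nbhs_normP[r /= r0 hr].
have key h : `|h| < r -> `|c (h + t) - c t - h *: 'D_1 c t| <= e * `|h|.
  move=> hr'; have [->|h0] := eqVneq h 0.
    by rewrite add0r subrr scale0r subrr !normr0 mulr0.
  have := hr h; rewrite /= sub0r normrN => /(_ hr' h0) H.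
  have -> : c (h + t) - c t - h *: 'D_1 c t =
     - (h *: ('D_1 c t - h^-1 *: (c (h + t) - c t))).
    by rewrite scalerBr scalerA divff// scale1r opprB.
  by rewrite normrN normrZ mulrC ler_wpM2r.
exists r => // s u _ st tu _ usr.
have H1 := key (u - t); have H2 := key (s - t).
rewrite !subrK in H1 H2.
rewrite (ger0_norm (_ : 0 <= u - t)) in H1; last lra.
rewrite (ler0_norm (_ : s - t <= 0)) in H2; last lra.
have {}H1 := H1 ltac:(lra); have {}H2 := H2 ltac:(lra).
have -> : u - s = (u - t) - (s - t) by lra.
rewrite scalerBl (subrB_shift _ _ (c t)).
apply: le_trans (ler_normB _ _) _; lra.
Qed.

(** A point of [S] just below [sup S] can be joined to any point just above by one interval around
    [sup S], so the supremum cannot lie below [b]. *)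
Lemma cousin (P : R -> R -> Prop) (a b : R) : a <= b ->
  (forall s t u, a <= s -> s <= t -> t <= u -> u <= b ->
    P s t -> P t u -> P s u) ->
  (forall t, a <= t -> t <= b -> exists2 r : R, 0 < r &
    forall s u, a <= s -> s <= t -> t <= u -> u <= b -> u - s < r -> P s u) ->
  P a b.
Proof.
move=> ab Ptr Ploc.
pose S := [set t | [/\ a <= t, t <= b & P a t]].
have Sa : S a.
  by have [r r0 h] := Ploc a (lexx _) ab; split=> //; apply: h => //; rewrite subrr.
have Sb : has_sup S by split; [exists a | exists b => t []].
have aT : a <= sup S by apply: sup_upper_bound.
have Tb : sup S <= b by apply: ge_sup; [exists a | move=> t []].
have [r r0 h] := Ploc _ aT Tb.
have r3 : 0 < r / 3%:R by lra.
have [s Ss sT] := sup_adherent r3 Sb.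
have sT' := sup_upper_bound Sb Ss.
have ext u : sup S <= u -> u <= b -> u < sup S + r / 3%:R -> P a u.
  move=> Tu ub ur; case: Ss => as_ sb Pas.
  by apply: (Ptr _ s) => //; [lra | apply: h => //; lra].
have [bT|Tb'] := lerP b (sup S); first by apply: ext => //; lra.
pose u := Num.min b (sup S + r / 4%:R).
have [ub ur] : u <= b /\ u <= sup S + r / 4%:R by split; rewrite ge_min lexx ?orbT.
have Tu : sup S < u by rewrite lt_min Tb' /=; lra.
have : S u by split; [lra | | apply: ext; lra].
by move/(sup_upper_bound Sb); lra.
Qed.

(** For the slope [k + e'] the bound is additive over adjacent intervals and holds on all short
    ones, so Cousin's lemma applies. *)
Lemma straddle_le_incr a b (g : R -> R) k : a <= b ->
  (forall t, a <= t -> t <= b -> straddle_le a b g t k) ->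
  g b - g a <= k * (b - a).
Proof.
move=> ab h; apply/ler_addgt0Pl => e e0.
pose e' := e / (b - a + 1); have e'0 : 0 < e' by apply: divr_gt0; lra.
have : g b - g a <= (k + e') * (b - a).
  apply: (cousin (P := fun s u => g u - g s <= (k + e') * (u - s))) => //.
    by move=> s t u *; lra.
  by move=> t at_ tb; exact: h.
have : e' * (b - a) <= e.
  by rewrite /e' mulrAC ler_pdivrMr; [rewrite ler_pM2l|]; lra.
by lra.
Qed.

(** Holds the pieces that meet an exceptional set. Keeping them ordered makes concatenation match
    the additivity step of Cousin's lemma and yields the disjointness that [abs_continuous] asks
    for. *)
Fixpoint chain (s : R) (l : seq (R * R)) (t : R) : Prop :=
  if l is p :: l' then [/\ s <= p.1, p.1 <= p.2 & chain p.2 l' t] else s <= t.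

Lemma chain_le s l t : chain s l t -> s <= t.
Proof.
elim: l s => [//|p l IH] s [sp pp /IH]; exact: le_trans (le_trans sp pp).
Qed.

Lemma chain_weaken s s' l t : s' <= s -> chain s l t -> chain s' l t.
Proof.
by case: l => [|p l] ss /= => [st|[sp pp h]]; [|split=> //]; exact: le_trans ss _.
Qed.

Lemma chain_cat s l t l' u : chain s l t -> chain t l' u -> chain s (l ++ l') u.
Proof.
elim: l s => [|p l IH] s /=; first exact: chain_weaken.
by move=> [sp pp h] h'; split=> //; apply: IH.
Qed.

Lemma chain_nth s l t i : chain s l t -> (i < size l)%N ->
  [/\ s <= (nth (0, 0) l i).1, (nth (0, 0) l i).1 <= (nth (0, 0) l i).2
    & (nth (0, 0) l i).2 <= t].
Proof.
elim: l s i => [//|p l IH] s [|i] /= [sp pp h] il.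
  by split=> //; apply: chain_le h.
have [h1 h2 h3] := IH _ i h il; split=> //.
exact: le_trans (le_trans sp pp) h1.
Qed.

Lemma chain_disjoint s l t i j : chain s l t -> (i < j)%N -> (j < size l)%N ->
  (nth (0, 0) l i).2 <= (nth (0, 0) l j).1.
Proof.
elim: l s i j => [//|p l IH] s [|i] [|j] //= [sp pp h] ij jl.
  by have [] := chain_nth h jl.
exact: (IH _ _ _ h).
Qed.

Lemma chain_trivIset s l t : chain s l t ->
  trivIset setT (fun i : 'I_(size l) =>
    `](nth (0, 0) l i).1, (nth (0, 0) l i).2[%classic).
Proof.
move=> h i j _ _ [x [/= + +]]; rewrite !in_itv /= => /andP[x1 x2] /andP[x3 x4].
apply/val_inj => /=; case: (ltngtP i j) => // ij.
  by exfalso; have := chain_disjoint h ij (ltn_ord j); lra.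
by exfalso; have := chain_disjoint h ij (ltn_ord i); lra.
Qed.

Lemma null_open_cover (N : set R) (d : R) : 0 < d ->
  (@lebesgue_measure R).-negligible N ->
  exists O, [/\ open O, N `<=` O & (lebesgue_measure O < d%:E)%E].
Proof.
move=> d0 [B [mB B0 NB]].
have B0' : lebesgue_measure B = 0%E by exact: B0.
have Bfin : (lebesgue_measure B < +oo)%E by rewrite B0' ltry.
have [U [oU BU Ud]] := lebesgue_regularity_outer mB Bfin d0.
exists U; split=> //; first exact: subset_trans NB BU.
have B0'' : lebesgue_measure (U `&` B) = 0%E.
  apply/eqP; rewrite eq_le measure_ge0 andbT -B0'.
  by apply: le_measure; rewrite ?inE//; apply: measurableI => //;
    apply: open_measurable.
suff -> : lebesgue_measure U = lebesgue_measure (U `\` B) by [].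
rewrite -[RHS]adde0 -B0''.
by apply: measureDI => //; apply: open_measurable.
Qed.

(* Off a null set the increments are controlled by [straddle_le]; the tagged
   pieces meeting the null set have small total length, hence contribute little
   by absolute continuity. *)
Lemma abs_continuous_incr a b (g : R -> R) k : a <= b ->
  abs_continuous a b g ->
  {ae @lebesgue_measure R, forall t, a < t < b -> straddle_le a b g t k} ->
  g b - g a <= k * (b - a).
Proof.
move=> ab gac gae; apply/ler_addgt0Pl => e e0.
(* One third of [e] each: for the slope excess [e'], for the increments of [g] over the exceptional
   pieces, and for [K] times the length of those pieces. *)
pose e1 := e / 3%:R; have e10 : 0 < e1 by rewrite /e1; lra.
pose e' := e1 / (b - a + 1); have e'0 : 0 < e' by apply: divr_gt0; lra.
have e'ab : e' * (b - a) <= e1.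
  by rewrite /e' mulrAC ler_pdivrMr; [rewrite ler_pM2l|]; lra.
have [d1 d10 hd1] := gac _ e10.
pose K := `|k + e'|.
have K0 : 0 <= K by rewrite normr_ge0.
pose d := Num.min d1 (e1 / (K + 1)).
have d0 : 0 < d by rewrite lt_min d10 divr_gt0//; lra.
pose N := ~` [set t | a < t < b -> straddle_le a b g t k].
(* The slope bound is assumed only inside the interval, so its ends join the null set. *)
have nN : (@lebesgue_measure R).-negligible (N `|` ([set a] `|` [set b])).
  apply: negligibleU; first exact: gae.
  by apply: negligibleU; apply/negligibleP => //; exact: lebesgue_measure_set1.
have [ O [oO NO Od]] := null_open_cover d0 nN.
(* Half-open intervals make [w] additive under concatenation. In [Q], the term with [K] pays for
   pieces on which [(k + e') * (t - s)] may be negative. *)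
pose w s t := lebesgue_measure (O `&` `]s, t]).
pose Q s t := exists l, [/\ chain s l t,
  ((\sum_(p <- l) (p.2 - p.1))%:E <= w s t)%E &
  g t - g s <= (k + e') * (t - s) +
    \sum_(p <- l) (`|g p.2 - g p.1| + K * (p.2 - p.1))].
have oc (s t x : R) : `]s, t]%classic x -> s < x /\ x <= t.
  by rewrite /= in_itv => /andP[].
have [l [hl lw lg]] : Q a b.
  apply: cousin => //.
    move=> s t u as_ st tu ub [l [hl lw lg]] [l' [hl' lw' lg']].
    exists (l ++ l'); split; first exact: chain_cat hl hl'.
      rewrite big_cat /= EFinD; apply: le_trans (leeD lw lw') _.
      rewrite /w -measureU//; last 3 first.
      - by apply: measurableI => //; apply: open_measurable.
      - by apply: measurableI => //; apply: open_measurable.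
      - by apply/seteqP; split=> // x [[_ /oc[_ ?]] [_ /oc[? _]]]; exfalso; lra.
      apply: le_measure; rewrite ?inE.
      + by apply: measurableU; apply: measurableI => //; apply: open_measurable.
      + by apply: measurableI => //; apply: open_measurable.
      + by move=> x [] [Ox /oc[? ?]]; split=> //=; rewrite in_itv /=; lra.
    by rewrite big_cat /=; lra.
  move=> t at_ tb; have [Ot|Ot] := pselect (O t).
    have /nbhs_normP[r /= r0 hr] := open_nbhs_nbhs (conj oO Ot).
    exists r => // s u as_ st tu ub us; exists [:: (s, u)]; split=> /=.
    - by split=> //; lra.
    - rewrite big_seq1 /= /w (_ : O `&` _ = `]s, u]%classic).
        rewrite lebesgue_measure_itv /= lte_fin; case: ltP => [_|us'] /=.
          by rewrite EFinB.
        by rewrite lee_fin; lra.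
      apply/seteqP; split=> [x []//|x xsu]; split=> //; apply: hr => /=.
      by have [? ?] := oc _ _ _ xsu; rewrite ltr_norml; lra.
    - rewrite big_seq1 /=.
      have : (- K) * (u - s) <= (k + e') * (u - s).
        by apply: ler_wpM2r; [lra | rewrite /K lerNl -normrN; exact: ler_norm].
      by have := ler_norm (g u - g s); lra.
  have [at' tb'] : a < t /\ t < b.
    split; rewrite lt_neqAle ?at_ ?tb andbT; apply/eqP => E; apply: Ot; apply: NO.
      by right; left.
    by right; right.
  have ht : straddle_le a b g t k.
    by apply: contrapT => nt; apply/Ot/NO; left => h; apply: nt; apply: h;
      rewrite at' tb'.
  have [r r0 hr] := ht e' e'0; exists r => // s u as_ st tu ub us.
  exists [::]; split=> /=; first lra.
    by rewrite big_nil; exact: measure_ge0.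
  by rewrite big_nil addr0; exact: hr.
have sd : \sum_(p <- l) (p.2 - p.1) < d.
  rewrite -lte_fin; apply: le_lt_trans lw _; apply: le_lt_trans Od.
  by apply: le_measure; rewrite ?inE//; [apply: measurableI => //|];
    apply: open_measurable.
have bigE (F : R * R -> R) :
    \sum_(p <- l) F p = \sum_(i < size l) F (nth (0, 0) l i).
  by rewrite (big_nth (0, 0)) big_mkord.
have sg : \sum_(p <- l) `|g p.2 - g p.1| < e1.
  rewrite bigE.
  apply: (hd1 _ (fun i => (nth (0, 0) l (nat_of_ord i)).1) (fun i => (nth (0,
    0) l (nat_of_ord i)).2)).
  - by move=> i; apply: chain_nth hl (ltn_ord i).
  - exact: chain_trivIset hl.
  - by rewrite -(bigE (fun p => p.2 - p.1)); apply: lt_le_trans sd _;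
      rewrite ge_min lexx.
have Kd : K * \sum_(p <- l) (p.2 - p.1) <= e1.
  apply: le_trans (_ : K * (e1 / (K + 1)) <= _).
    apply: ler_wpM2l => //; apply: le_trans (ltW sd) _.
    by rewrite ge_min lexx orbT.
  by rewrite mulrCA ger_pMr// ler_pdivrMr; lra.
rewrite big_split /= -mulr_sumr in lg.
by rewrite /e1 in e'ab sg Kd *; lra.
Qed.

End EpsilonDelta.

(** * From derivatives almost everywhere to derivatives everywhere *)

Section ContinuousDerivative.
Context {R : realType}.

Lemma ae_lebesgueS (P Q : R -> Prop) : (forall x, P x -> Q x) ->
  {ae @lebesgue_measure R, forall x, P x} ->
  {ae @lebesgue_measure R, forall x, Q x}.
Proof. by move=> PQ; apply: negligibleS => x /= nQ /PQ. Qed.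

Lemma abs_continuous_sub (V : normedModType R) (a b a' b' : R) (c : R -> V) :
  a <= a' -> b' <= b -> abs_continuous a b c -> abs_continuous a' b' c.
Proof.
move=> aa bb h e e0; have [d d0 hd] := h e e0; exists d => // m u v uv.
by apply: hd => i; have [*] := uv i; split=> //; lra.
Qed.

Lemma abs_continuous_contract (V W : normedModType R) (a b : R) (c : R -> V)
    (g : R -> W) :
  (forall s u, `|g u - g s| <= `|c u - c s|) ->
  abs_continuous a b c -> abs_continuous a b g.
Proof.
move=> gc h e e0; have [d d0 hd] := h e e0; exists d => // m u v uv uvT sd.
by apply: le_lt_trans (hd m u v uv uvT sd); apply: ler_sum => i _; apply: gc.
Qed.

Lemma abs_continuous_continuous (V : normedModType R) (a b : R) (c : R -> V) :
  abs_continuous a b c -> {within `[a, b], continuous c}.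
Proof.
move=> h; apply/within_continuousP => t + e e0; rewrite /= in_itv /= => /andP[? ?].
have [d d0 hd] := h e e0; exists d => // s; rewrite /= in_itv /= => /andP[? ?].
have key u v : a <= u -> u <= v -> v <= b -> v - u < d -> `|c v - c u| < e.
  move=> au uv vb vu.
  have := hd 1%N (fun=> u) (fun=> v); rewrite !big_ord1; apply=> //.
  by move=> i j _ _ _; rewrite !ord1.
have [st|ts] := lerP s t => ?.
  by rewrite distrC; apply: key => //; lra.
by apply: key => //; lra.
Qed.

Lemma straddle_contract (V W : normedModType R) (a b t : R) (c : R -> V)
    (g : R -> W) v w :
  (forall s u, `|g u - g s - (u - s) *: w| <= `|c u - c s - (u - s) *: v|) ->
  straddle a b c t v -> straddle a b g t w.
Proof.
move=> gc h e e0; have [d d0 hd] := h e e0; exists d => // s u *.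
by apply: le_trans (gc s u) _; apply: hd.
Qed.

(** Near [t] the slope of [g] lies almost everywhere between [f t - e] and [f t + e]; the mean value
    inequality for absolutely continuous functions, applied to [g] and to [- g], carries both bounds
    over to increments. The ends of the interval are included. *)
Lemma ae_derive_straddle (g f : R -> R) a b :
  abs_continuous a b g ->
  {ae @lebesgue_measure R, forall t, a < t < b -> straddle a b g t (f t)} ->
  {within `[a, b], continuous f} ->
  forall t, a <= t <= b -> straddle a b g t (f t).
Proof.
move=> gac gae /within_continuousP cf t /andP[at_ tb] e e0.
have tab : `[a, b]%classic t by rewrite /= in_itv /= at_.
have [r r0 hr] := cf t tab e e0; exists r => // s u as_ st tu ub us.
have su : s <= u by lra.
have fclose x : s <= x -> x <= u -> `|f x - f t| < e.
  move=> sx xu; apply: hr; first by rewrite /= in_itv /=; lra.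
  by rewrite ltr_norml; lra.
have up : g u - g s <= (f t + e) * (u - s).
  apply: abs_continuous_incr => //; first exact: abs_continuous_sub gac.
  apply: ae_lebesgueS gae => x + /andP[sx xu]; rewrite (_ : a < x < b); last lra.
  move=> /(_ isT) hx; apply: straddle_le_weaken (straddle_straddle_le
    (straddle_sub _ _ hx)) => //.
  by have := fclose x (ltW sx) (ltW xu); rewrite ltr_norml; lra.
have dn : (- g u) - (- g s) <= (- f t + e) * (u - s).
  apply: (@abs_continuous_incr _ _ _ (fun x => - g x)) => //.
    apply: abs_continuous_contract (abs_continuous_sub as_ ub gac) => x y.
    by rewrite -opprD normrN.
  apply: ae_lebesgueS gae => x + /andP[sx xu]; rewrite (_ : a < x < b); last lra.
  move=> /(_ isT) hx; apply: (@straddle_le_weaken _ _ _ _ _ (- f x)).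
    by have := fclose x (ltW sx) (ltW xu); rewrite ltr_norml; lra.
  apply: straddle_straddle_le; apply: straddle_contract (straddle_sub as_ ub hx).
  by move=> y z; rewrite scalerN -!opprD normrN.
by rewrite /GRing.scale /= ler_norml; lra.
Qed.

Lemma rV_coord_norm n (v : 'rV[R]_n) i : `|v 0 i| <= `|v|.
Proof.
rewrite [`|v|]mx_normrE.
by apply: (le_bigmax _ (fun ij : 'I_1 * 'I_n => `|v ij.1 ij.2|) (0, i)).
Qed.

Lemma rV_norm_le n (v : 'rV[R]_n) e :
  0 <= e -> (forall i, `|v 0 i| <= e) -> `|v| <= e.
Proof.
move=> e0 h; rewrite [`|v|]mx_normrE; apply: bigmax_le => // -[i j] _ /=.
by rewrite ord1.
Qed.

Lemma ae_derive_straddle_rV n (c F : R -> 'rV[R]_n) a b :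
  abs_continuous a b c ->
  {ae @lebesgue_measure R, forall t, a < t < b -> straddle a b c t (F t)} ->
  {within `[a, b], continuous F} ->
  forall t, a <= t <= b -> straddle a b c t (F t).
Proof.
move=> cac cae /within_continuousP cF t tab e e0.
have coordD i s u w : (c u - c s - (u - s) *: w) 0 i =
    c u 0 i - c s 0 i - (u - s) *: w 0 i by rewrite !mxE.
have hi i : straddle a b (fun s => c s 0 i) t (F t 0 i).
  apply: (@ae_derive_straddle (fun s => c s 0 i) (fun s => F s 0 i)) => //.
  - apply: abs_continuous_contract cac => s u.
    by have := rV_coord_norm (c u - c s) i; rewrite !mxE.
  - apply: ae_lebesgueS cae => x + xab => /(_ xab); apply: straddle_contract => s u.
    by rewrite -coordD; exact: rV_coord_norm.
  - apply/within_continuousP => x xab d d0; have [r r0 hr] := cF x xab d d0.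
    exists r => // y yab yx; apply: le_lt_trans (hr y yab yx).
    by have := rV_coord_norm (F y - F x) i; rewrite !mxE.
have {}hi i : exists r : R, 0 < r /\ forall s u,
    a <= s -> s <= t -> t <= u -> u <= b -> u - s < r ->
    `|c u 0 i - c s 0 i - (u - s) *: F t 0 i| <= e * (u - s).
  by have [r r0 hr] := hi i e e0; exists r.
have [r hr] := choice hi.
(* The minimum starts from 1 because there may be no coordinates. *)
exists (\big[Num.min/1]_i r i).
  apply: (big_ind (fun x => 0 < x)) => // [x y x0 y0|i _]; last by have [] := hr i.
  by rewrite lt_min x0.
move=> s u as_ st tu ub us; apply: rV_norm_le => [|i].
  by apply: mulr_ge0; lra.
have [_ h] := hr i; rewrite coordD; apply: h => //.
by apply: lt_le_trans us _; exact: bigmin_le_cond.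
Qed.

End ContinuousDerivative.

(** * Comparison functions, their inverses and an explicit KL estimate *)

Section ComparisonFunctions.
Context {R : realType}.
Implicit Types f g : R -> R.

Lemma class_K_ge0 f s : class_K f -> 0 <= s -> 0 <= f s.
Proof.
by move=> [_ f0 fi]; rewrite le_eqVlt => /predU1P[<-|/(fi _ _ (lexx _))];
  rewrite f0 // => /ltW.
Qed.

Lemma class_K_gt0 f s : class_K f -> 0 < s -> 0 < f s.
Proof. by move=> [_ f0 fi] /(fi _ _ (lexx _)); rewrite f0. Qed.

Lemma class_K_le f s t : class_K f -> 0 <= s -> s <= t -> f s <= f t.
Proof.
by move=> [_ _ fi] s0; rewrite le_eqVlt => /predU1P[->//|/(fi _ _ s0)/ltW].
Qed.

Lemma class_K_le_inv f s t : class_K f -> 0 <= t -> f s <= f t -> s <= t.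
Proof.
by move=> [_ _ fi] t0; rewrite leNgt => fst; rewrite leNgt;
  apply: contra fst => /(fi _ _ t0).
Qed.

(** A strictly increasing map onto the half-line has no room for a jump. With surjectivity in place
    of continuity, compositions and inverses need no limit argument. *)
Lemma class_KooP f : class_Koo f <->
  [/\ f 0 = 0, forall s t, 0 <= s -> s < t -> f s < f t
    & forall y, 0 <= y -> exists2 s, 0 <= s & f s = y].
Proof.
split=> [[[cf f0 fi] fu]|[f0 fi fs]].
  split=> // y y0; have [s s0 ys] := fu y.
  have [||c + fc] := IVT s0 (f := f) (v := y).
  - by apply: continuous_subspaceW cf => x /=; rewrite in_itv /= => /andP[].
  - by rewrite f0 ge_min y0 /= le_max (ltW ys) orbT.
  - by rewrite in_itv /= => /andP[c0 _]; exists c.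
have fge s : 0 <= s -> 0 <= f s.
  by rewrite le_eqVlt => /predU1P[<-|/(fi _ _ (lexx _))]; rewrite f0 // => /ltW.
have fle s t : 0 <= t -> f s < f t -> s < t.
  move=> t0; rewrite !ltNge; apply: contra; rewrite le_eqVlt.
  by move=> /predU1P[->//|/(fi _ _ t0)/ltW].
split; last first.
  move=> M; have [s s0 fsM] := fs (Num.max M 0 + 1) ltac:(rewrite addr_ge0//
    le_max lexx orbT//).
  exists s => //; rewrite fsM; apply: le_lt_trans (_ : Num.max M 0 < _).
    by rewrite le_max lexx.
  by rewrite ltrDl.
split=> //; apply/within_continuousP => s s0 e e0.
have [u u0 fu] := fs (f s + e) (addr_ge0 (fge s s0) (ltW e0)).
have su : s < u by apply: fle => //; rewrite fu; lra.
have [d d0 hd] : exists2 d, 0 < d & forall t, 0 <= t -> s - d < t -> f s - e < f t.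
  have [es|es] := lerP e (f s); last first.
    by exists 1 => // t t0 _; have := fge t t0; lra.
  have [w w0 fw] := fs (f s - e) ltac:(lra).
  have ws : w < s by apply: fle => //; rewrite fw; lra.
  exists (s - w) => [|t t0 wt]; first lra.
  by rewrite -fw; apply: fi => //; lra.
exists (Num.min d (u - s)) => [|t t0]; first by rewrite lt_min d0 /=; lra.
rewrite lt_min => /andP[]; rewrite !ltr_norml => /andP[? ?] /andP[? ?].
have : f s - e < f t by apply: hd => //; lra.
have : f t < f u by apply: fi => //; lra.
by rewrite fu; lra.
Qed.

Lemma class_Koo_comp f g : class_Koo f -> class_Koo g -> class_Koo (f \o g).
Proof.
move=> Kf Kg; have [[_ _ fi] _] := Kf; have [[_ _ gi] _] := Kg.
move: (Kf) (Kg) => /class_KooP[f0 _ fs] /class_KooP[g0 _ gs].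
apply/class_KooP; split=> /=; first by rewrite g0.
  by move=> s t s0 st; apply: fi; [apply: class_K_ge0 Kg.1 s0 | exact: gi].
by move=> y /fs[z z0 <-]; have [s s0 <-] := gs z z0; exists s.
Qed.

Lemma class_Koo_add f g : class_Koo f -> class_Koo g -> class_Koo (fun s => f s + g s).
Proof.
move=> [[cf f0 fi] fu] Kg; have [[cg g0 gi] _] := Kg; split; first split.
- exact: (within_continuousD cf cg).
- by rewrite f0 g0 addr0.
- by move=> s t s0 st; apply: ltrD; [exact: fi|exact: gi].
- move=> M; have [s s0 Ms] := fu M; exists s => //.
  by have := class_K_ge0 Kg.1 s0; lra.
Qed.

Lemma class_Koo_id : class_Koo (fun s : R => s).
Proof. by apply/class_KooP; split=> // y y0; exists y. Qed.

Lemma class_Koo_eq f g : (forall s, 0 <= s -> f s = g s) ->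
  class_Koo f -> class_Koo g.
Proof.
move=> fg /class_KooP[f0 fi fs]; apply/class_KooP; split.
- by rewrite -fg.
- by move=> s t s0 st; rewrite -!fg//; [exact: fi | lra].
- by move=> y /fs[s s0 <-]; exists s; rewrite ?fg.
Qed.

Lemma inv_nonneg_spec f y : class_Koo f -> 0 <= y ->
  0 <= inv_nonneg f y /\ f (inv_nonneg f y) = y.
Proof.
move=> Kf y0; have [_ fi fs] := (class_KooP f).1 Kf.
have [s s0 <-] := fs y y0.
rewrite /inv_nonneg pinvKV ?inE// => x z; rewrite !inE /nonneg/= => x0 z0 E.
by apply/le_anti/andP; split; apply: (class_K_le_inv Kf.1) => //; rewrite E.
Qed.

Lemma inv_nonnegK f s : class_Koo f -> 0 <= s -> inv_nonneg f (f s) = s.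
Proof.
move=> Kf s0; have [i0 E] := inv_nonneg_spec Kf (class_K_ge0 Kf.1 s0).
by apply/le_anti/andP; split; apply: (class_K_le_inv Kf.1) => //; rewrite E.
Qed.

Lemma inv_nonneg_le f s y : class_Koo f -> 0 <= s -> 0 <= y ->
  f s <= y -> s <= inv_nonneg f y.
Proof.
move=> Kf s0 y0 h; have [i0 E] := inv_nonneg_spec Kf y0.
by apply: (class_K_le_inv Kf.1) => //; rewrite E.
Qed.

Lemma class_Koo_inv f : class_Koo f -> class_Koo (inv_nonneg f).
Proof.
move=> Kf; have [f0 fi fs] := (class_KooP f).1 Kf; apply/class_KooP; split.
- by rewrite -{1}f0 inv_nonnegK.
- move=> s t s0 st.
  have [i0 E] := inv_nonneg_spec Kf s0.
  have [i0' E'] := inv_nonneg_spec Kf (le_trans s0 (ltW st)).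
  rewrite ltNge; apply/negP => /(class_K_le Kf.1 i0').
  by rewrite E E'; lra.
- by move=> y y0; exists (f y); [exact: class_K_ge0 Kf.1 y0|exact: inv_nonnegK].
Qed.

Lemma within_continuous_within_comp (U V W : normedModType R) (A : set U) (B : set V)
    (f : U -> V) (g : V -> W) : {homo f : x / A x >-> B x} ->
  {within A, continuous f} -> {within B, continuous g} ->
  {within A, continuous (g \o f)}.
Proof.
move=> AB /within_continuousP cf /within_continuousP cg.
apply/within_continuousP => x Ax e e0.
have [d d0 hd] := cg _ (AB _ Ax) e e0; have [d' d'0 hd'] := cf _ Ax d d0.
by exists d' => // y Ay yx; apply: hd; [exact: AB|exact: hd'].
Qed.

(* The witness is [inf_v psi v + max (u - v) 0], the largest nondecreasing
   1-Lipschitz minorant of [psi]. *)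
Lemma lipschitz_minorant (psi : R -> R) (M : R) : 0 < M ->
  {within `[0, M], continuous psi} -> psi 0 = 0 ->
  (forall s, 0 < s -> s <= M -> 0 < psi s) ->
  exists c : R -> R, [/\ c 0 = 0,
    forall u, 0 < u -> 0 < c u,
    forall u v, u <= v -> c u <= c v /\ c v <= c u + (v - u)
    & forall u, 0 <= u -> u <= M -> c u <= psi u].
Proof.
move=> M0 cpsi psi0 psi_gt0.
have psi_ge0 v : 0 <= v -> v <= M -> 0 <= psi v.
  rewrite le_eqVlt => /predU1P[<- _|v0 vM]; first by rewrite psi0.
  exact: ltW (psi_gt0 _ v0 vM).
pose E u := [set psi v + Num.max (u - v) 0 | v in `[0, M]%classic].
have mx0 (x : R) : 0 <= Num.max x 0 by rewrite le_max lexx orbT.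
have Ein u v : 0 <= v -> v <= M -> E u (psi v + Num.max (u - v) 0).
  by move=> v0 vM; exists v => //=; rewrite in_itv /= v0.
have Elb u : lbound (E u) 0.
  move=> _ [v /= + <-]; rewrite in_itv /= => /andP[v0 vM].
  by apply: addr_ge0 => //; apply: psi_ge0.
have E0 u : E u !=set0 by eexists; apply: (Ein u 0) => //; exact: ltW.
have Einf u v : 0 <= v -> v <= M -> inf (E u) <= psi v + Num.max (u - v) 0.
  by move=> v0 vM; apply: ge_inf; [exists 0; exact: Elb | exact: Ein].
have cpos u : 0 <= inf (E u) by apply: lb_le_inf.
have cle u : 0 <= u -> u <= M -> inf (E u) <= psi u.
  by move=> u0 uM; apply: le_trans (Einf u u u0 uM) _; rewrite subrr maxxx addr0.
exists (fun u => inf (E u)); split=> //.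
- by apply/le_anti; rewrite cpos -[leRHS]psi0 cle// ltW.
(* For [v >= w] the term [psi v] is at least the minimum of [psi] over the compact interval from [w]
   to [M]; for [v < w] the term [u - v] is at least [u / 2]. *)
- move=> u u0; pose w := Num.min (u / 2) M.
  have w0 : 0 < w by rewrite lt_min M0 andbT; lra.
  have wM : w <= M by rewrite ge_min lexx orbT.
  have wu : w <= u / 2 by rewrite ge_min lexx.
  have [|m + hm] := EVT_min wM (f := psi).
    apply: continuous_subspaceW cpsi => x /=; rewrite !in_itv /= => /andP[? ?]; lra.
  rewrite in_itv /= => /andP[wm mM].
  have m0 : 0 < psi m by apply: psi_gt0 => //; lra.
  have k0 : 0 < Num.min (psi m) (u / 2) by rewrite lt_min m0; lra.
  apply: (lt_le_trans k0); apply: lb_le_inf => // _ [v /= + <-].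
  rewrite in_itv /= => /andP[v0 vM]; have [wv|vw] := lerP w v.
    rewrite ge_min; apply/orP; left; rewrite -[leLHS]addr0 lerD//.
    by apply: hm; rewrite in_itv /= wv.
  rewrite ge_min; apply/orP; right.
  have := psi_ge0 v v0 vM; have : u - v <= Num.max (u - v) 0 by rewrite le_max lexx.
  by lra.
- move=> u v uv; split.
    apply: lb_le_inf => // _ [x /= + <-]; rewrite in_itv /= => /andP[x0 xM].
    apply: le_trans (Einf u x x0 xM) _; rewrite lerD2l.
    by rewrite ge_max !le_max lexx !orbT andbT; apply/orP; left; lra.
  rewrite -lerBlDr; apply: lb_le_inf => // _ [x /= + <-].
  rewrite in_itv /= => /andP[x0 xM]; rewrite lerBlDr.
  apply: le_trans (Einf v x x0 xM) _; rewrite -addrA lerD2l ge_max.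
  have := mx0 (u - x); have : u - x <= Num.max (u - x) 0 by rewrite le_max lexx.
  by move=> ? ?; apply/andP; split; lra.
Qed.

Section Decay.
Variable c : R -> R.
Hypotheses (c0 : c 0 = 0) (c_gt0 : forall u, 0 < u -> 0 < c u)
  (c_lip : forall u v, u <= v -> c u <= c v /\ c v <= c u + (v - u)).

Lemma decay_rate_ge0 u : 0 <= u -> 0 <= c u.
Proof. by move=> /c_lip[+ _]; rewrite c0. Qed.

(* The decay estimate obtained below is [U t + t * c (U t) <= U 0], so the comparison
   function is the inverse of [u |-> u + t * c u]. *)
Definition decay (s t : R) := inv_nonneg (fun u => u + t * c u) s.

Lemma class_Koo_decay_inv t : 0 <= t -> class_Koo (fun u => u + t * c u).
Proof.
move=> t0; split; first split.
- apply/within_continuousP => u u0 e e0.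
  exists (e / (1 + t)) => [|v v0]; first by apply: divr_gt0; lra.
  rewrite ltr_pdivlMr; last lra.
  have -> : v + t * c v - (u + t * c u) = (v - u) + t * (c v - c u) by ring.
  move=> h; apply: le_lt_trans h; rewrite [leRHS]mulrDr mulr1.
  apply: le_trans (ler_normD _ _) _;
    rewrite lerD2l normrM ger0_norm// mulrC ler_wpM2r//.
  have [uv|/ltW vu] := leP u v.
    by have [? ?] := c_lip uv; rewrite !ger0_norm; lra.
  by have [? ?] := c_lip vu; rewrite !ler0_norm; lra.
- by rewrite c0 mulr0 addr0.
- move=> s u s0 su; have [h _] := c_lip (ltW su).
  by apply: ltr_leD => //; apply: ler_wpM2l.
- move=> M; exists (Num.max M 0 + 1).
    by apply: addr_ge0 => //; rewrite le_max lexx orbT.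
  have M1 : M <= Num.max M 0 by rewrite le_max lexx.
  have M2 : 0 <= Num.max M 0 by rewrite le_max lexx orbT.
  have : 0 <= t * c (Num.max M 0 + 1).
    by apply: mulr_ge0 => //; apply: decay_rate_ge0; lra.
  by lra.
Qed.

Lemma class_Koo_decay t : 0 <= t -> class_Koo (decay^~ t).
Proof. by move=> t0; apply: class_Koo_inv; exact: class_Koo_decay_inv. Qed.

Lemma decayE s t : 0 <= s -> 0 <= t ->
  0 <= decay s t /\ decay s t + t * c (decay s t) = s.
Proof.
by move=> s0 t0; apply: (inv_nonneg_spec (class_Koo_decay_inv t0)).
Qed.

Lemma decay_ge s t u : 0 <= s -> 0 <= t -> 0 <= u ->
  u + t * c u <= s -> u <= decay s t.
Proof.
move=> s0 t0 u0; apply: (@inv_nonneg_le (fun u => u + t * c u)) => //.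
exact: class_Koo_decay_inv.
Qed.

Lemma decay_nonincreasing s t t' : 0 <= s -> 0 <= t -> t <= t' ->
  decay s t' <= decay s t.
Proof.
move=> s0 t0 tt'; have [d0 E] := decayE s0 (le_trans t0 tt').
apply: decay_ge => //; rewrite -[leRHS]E lerD2l ler_wpM2r//.
exact: decay_rate_ge0.
Qed.

(** Subtracting the two defining equations gives [(u' - u) + t' * (c u' - c u) = (s' - s) - (t' - t)
    * c u]. The terms on the left have the same sign since [c] is nondecreasing, so [u' - u] is
    bounded by the right-hand side, where [c u <= u <= s]. *)
Lemma decay_continuous :
  {within [set p : R * R | 0 <= p.1 /\ 0 <= p.2],
    continuous (fun p : R * R => decay p.1 p.2)}.
Proof.
apply/within_continuousP => -[s t] /= [s0 t0] e e0.
exists (e / (s + 2)) => [|[s' t'] /= [s'0 t'0]]; first by apply: divr_gt0; lra.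
rewrite prod_normE /= gt_max => /andP[ds dt].
have [u0 Eu] := decayE s0 t0; have [u0' Eu'] := decayE s'0 t'0.
set u := decay s t in u0 Eu *; set u' := decay s' t' in u0' Eu' *.
have cu0 := decay_rate_ge0 u0.
have cus : c u <= s.
  have [_] := c_lip u0; rewrite c0; have := mulr_ge0 t0 cu0; lra.
have tc : `|t' - t| * c u <= `|t' - t| * s by apply: ler_wpM2l.
have key : `|u' - u| <= `|s' - s| + `|t' - t| * c u.
  have [uu|/ltW uu] := leP u u'; have [h _] := c_lip uu.
    have : 0 <= t' * (c u' - c u) by apply: mulr_ge0 => //; lra.
    have : - (t' - t) * c u <= `|t' - t| * c u.
      by apply: ler_wpM2r => //; rewrite -normrN ler_norm.
    have := ler_norm (s' - s); rewrite (ger0_norm (_ : 0 <= u' - u)); last lra.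
    by lra.
  have : 0 <= t' * (c u - c u') by apply: mulr_ge0 => //; lra.
  have : (t' - t) * c u <= `|t' - t| * c u.
    by apply: ler_wpM2r => //; rewrite ler_norm.
  have := ler_norm (- (s' - s)); rewrite normrN (ler0_norm (_ : u' - u <= 0)); last lra.
  by lra.
apply: (le_lt_trans key); apply: (le_lt_trans (lerD (lexx _) tc)).
apply: (@lt_le_trans _ _ (e / (s + 2) + e / (s + 2) * (s + 1))); last first.
  have -> : e / (s + 2) + e / (s + 2) * (s + 1) = e by field; lra.
  exact: lexx.
apply: ltr_leD => //; apply: ler_pM => //; first exact: ltW.
by lra.
Qed.

(** The time change [T] lets one lemma serve both slices of a KLL function, the one in t and the one
    in j. *)
Lemma class_KL_decay (Theta a T : R -> R) : class_Koo Theta -> class_Koo a ->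
  {within nonneg, continuous T} -> (forall t, 0 <= t -> 0 <= T t) ->
  (forall t t', 0 <= t -> t <= t' -> T t <= T t') ->
  (forall K, exists2 t, 0 <= t & K < T t) ->
  class_KL (fun s t => Theta (decay (a s) (T t))).
Proof.
move=> KT Ka /within_continuousP cT T0 Tle Tu.
move: (KT) (Ka) => [[cTh Th0 _] _] [[/within_continuousP ca _ _] _]; split.
- have caT : {within [set p : R * R | 0 <= p.1 /\ 0 <= p.2],
      continuous (fun p : R * R => (a p.1, T p.2))}.
    apply/within_continuousP => -[s t] /= [s0 t0] e e0.
    have [d d0 hd] := ca s s0 e e0; have [d' d'0 hd'] := cT t t0 e e0.
    exists (Num.min d d') => [|[s' t'] /= [s'0 t'0]]; first by rewrite lt_min d0.
    rewrite !prod_normE /= gt_max !lt_min => /andP[/andP[h1 _] /andP[_ h2]].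
    by rewrite gt_max hd// hd'.
  have cd := within_continuous_within_comp _ caT decay_continuous.
  apply: (within_continuous_within_comp _ (cd _) cTh).
    move=> [s t] /= [s0 t0]; have [] // := decayE (class_K_ge0 Ka.1 s0) (T0 t t0).
  by move=> [s t] /= [s0 t0]; split; [exact: class_K_ge0 Ka.1 s0 | exact: T0].
- by move=> t t0; have [] := class_Koo_comp KT (class_Koo_comp (class_Koo_decay
    (T0 t t0)) Ka).
- move=> s s0; have as0 := class_K_ge0 Ka.1 s0; split.
    move=> t t' t0 tt'; apply: (class_K_le KT.1).
      by have [] := decayE as0 (T0 _ (le_trans t0 tt')).
    by apply: decay_nonincreasing => //; [exact: T0|exact: Tle].
  apply/cvgrPdist_lt => e e0.
  have [_ Ti Ts] := (class_KooP Theta).1 KT; have [z z0 Ez] := Ts e (ltW e0).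
  have z1 : 0 < z.
    rewrite lt_neqAle z0 andbT; apply/eqP => E; move: Ez e0.
    by rewrite -E Th0 => ->; rewrite ltxx.
  have cz0 := c_gt0 z1.
  (* [z] is the level that [Theta] sends to [e]; a decay value of at least [z] would force
     [T t * c z <= a s], which fails after [t1]. *)
  have [t1 t10 ht1] := Tu (a s / c z).
  near=> t; have t1t : t1 <= t by near: t; apply: nbhs_pinfty_ge; rewrite num_real.
  have t0 : 0 <= t by lra.
  have [d0 E] := decayE as0 (T0 t t0).
  rewrite sub0r normrN ger0_norm; last exact: class_K_ge0 KT.1 d0.
  rewrite -Ez; apply: Ti => //; rewrite ltNge; apply/negP => zd.
  have [h _] := c_lip zd.
  have : a s / c z < T t by apply: lt_le_trans ht1 (Tle _ _ t10 t1t).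
  rewrite ltr_pdivrMr//.
  have : T t * c z <= T t * c (decay (a s) (T t)) by apply: ler_wpM2l => //; exact: T0.
  by lra.
Unshelve. all: by end_near.
Qed.

End Decay.
End ComparisonFunctions.

(** * Slopes of maxima and of compositions with curves *)

Section StraddleCalculus.
Context {R : realType}.

Lemma straddle_lip (V : normedModType R) (a b t : R) (c : R -> V) v :
  a <= t -> t <= b -> straddle a b c t v -> exists2 r : R, 0 < r &
    forall u, a <= u -> u <= b -> `|u - t| < r ->
      `|c u - c t| <= (1 + `|v|) * `|u - t|.
Proof.
move=> at_ tb h; have [r r0 hr] := h 1 ltr01; exists r => // u au ub.
have tri (w : V) (x y : R) : 0 <= x -> `|w - x *: v| <= 1 * x -> `|w| <= (1 + `|v|) * x.
  move=> x0 hw; rewrite -(subrK (x *: v) w).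
  by apply: le_trans (ler_normD _ _) _; rewrite normrZ ger0_norm//; lra.
have [ut|/ltW tu] := lerP u t => hu.
  by rewrite distrC; apply: tri; [|lra|apply: hr => //; lra].
by apply: tri; [|lra|apply: hr => //; lra].
Qed.

Lemma straddle_continuous (V : normedModType R) (a b t : R) (c : R -> V) v :
  a <= t -> t <= b -> straddle a b c t v -> forall e, 0 < e ->
  exists2 r : R, 0 < r & forall u, a <= u -> u <= b -> `|u - t| < r ->
      `|c u - c t| < e.
Proof.
move=> at_ tb h e e0; have [r r0 hr] := straddle_lip at_ tb h.
have v0 : 0 <= `|v| by [].
exists (Num.min r (e / (1 + `|v|))) => [|u au ub].
  by rewrite lt_min r0 divr_gt0//; lra.
rewrite lt_min => /andP[ur ue]; apply: le_lt_trans (hr u au ub ur) _.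
by rewrite mulrC -ltr_pdivlMr//; lra.
Qed.

(** Only the branches active at [t] need a bound. Off a tie, continuity makes the maximum agree with
    one branch nearby; at a tie both bounds are available, and each branch starts at [s] below the
    maximum. *)
Lemma straddle_le_max (a b t k : R) (f g : R -> R) :
  a <= t -> t <= b ->
  (forall e, 0 < e -> exists2 r : R, 0 < r & forall u, a <= u -> u <= b ->
     `|u - t| < r -> `|f u - f t| < e) ->
  (forall e, 0 < e -> exists2 r : R, 0 < r & forall u, a <= u -> u <= b ->
     `|u - t| < r -> `|g u - g t| < e) ->
  (g t <= f t -> straddle_le a b f t k) ->
  (f t <= g t -> straddle_le a b g t k) ->
  straddle_le a b (fun u => Num.max (f u) (g u)) t k.
Proof.
move=> at_ tb.
have aux (F G : R -> R) : 
  (forall e, 0 < e -> exists2 r : R, 0 < r & forall u, a <= u -> u <= b ->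
     `|u - t| < r -> `|F u - F t| < e) ->
  (forall e, 0 < e -> exists2 r : R, 0 < r & forall u, a <= u -> u <= b ->
     `|u - t| < r -> `|G u - G t| < e) ->
  G t < F t -> straddle_le a b F t k ->
  straddle_le a b (fun u => Num.max (F u) (G u)) t k.
  move=> cF cG GF hF e e0.
  have d0 : 0 < (F t - G t) / 2 by lra.
  have [r1 r10 h1] := cF _ d0; have [r2 r20 h2] := cG _ d0.
  have [r3 r30 h3] := hF e e0.
  exists (Num.min r3 (Num.min r1 r2)) => [|s u as_ st tu ub].
    by rewrite !lt_min r10 r20 r30.
  rewrite !lt_min => /and3P[us3 us1 us2].
  have FG x : a <= x -> x <= b -> `|x - t| < r1 -> `|x - t| < r2 ->
      Num.max (F x) (G x) = F x.
    move=> ax xb x1 x2; apply: max_l.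
    have := h1 x ax xb x1; have := h2 x ax xb x2; rewrite !ltr_norml; lra.
  rewrite !FG; try by (rewrite ?ltr_norml; lra).
  exact: h3.
move=> cf cg hf hg; have [fg|gf|E] := ltrgtP (f t) (g t).
- have := aux g f cg cf fg (hg (ltW fg)).
  by rewrite (_ : (fun _ => _) = (fun u => Num.max (f u) (g u)))//;
    apply/funext => u; rewrite maxC.
- exact: aux cf cg gf (hf (ltW gf)).
move=> e e0; have [|r1 r10 h1] := hf _ e e0; first by rewrite E.
have [|r2 r20 h2] := hg _ e e0; first by rewrite E.
exists (Num.min r1 r2) => [|s u as_ st tu ub]; first by rewrite lt_min r10.
rewrite lt_min => /andP[us1 us2].
have := h1 s u as_ st tu ub us1; have := h2 s u as_ st tu ub us2.
have : f s <= Num.max (f s) (g s) by rewrite le_max lexx.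
have : g s <= Num.max (f s) (g s) by rewrite le_max lexx orbT.
by move=> *; rewrite lerBlDr ge_max; lra.
Qed.

(** The Clarke limit lets the base point vary, which suits increments that start at [c s] rather
    than at [c t]. *)
Lemma clarke_quotient_le n (U : 'rV[R]_n -> R) z v (L e : R) :
  (clarke U z v <= L%:E)%E -> 0 < e ->
  exists2 r : R, 0 < r & forall y h, `|y - z| < r -> 0 < h -> h < r ->
    U (y + h *: v) - U y <= (L + e) * h.
Proof.
move=> hc e0.
have : (clarke U z v < (L + e)%:E)%E.
  by apply: le_lt_trans hc _; rewrite lte_fin; lra.
move=> /ereal_inf_lt[_ [A FA <-] supA].
case: FA => -[P Q] /= [/nbhs_normP[r1 /= r10 h1] ].
rewrite /at_right /within /= => /nbhs_normP[r2 /= r20 h2] PQ.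
exists (Num.min r1 r2) => [|y h]; first by rewrite lt_min r10.
rewrite !lt_min => /andP[y1 _] h0 /andP[_ hr2].
have : A (y, h).
  apply: PQ; split=> /=; first by apply: h1 => /=; rewrite distrC.
  by apply: h2 => //=; rewrite sub0r normrN ger0_norm// ltW.
move=> Ayh; rewrite -ler_pdivrMr// -lee_fin ltW//; apply: le_lt_trans supA.
by apply: ereal_sup_ubound; exists (y, h).
Qed.

(** The Clarke quotient controls [U] along the straight step [c s + (u - s) *: v], and the Lipschitz
    property absorbs the distance from its end to [c u], which is small compared with [u - s]. *)
Lemma straddle_clarke n (U : 'rV[R]_n -> R) (c : R -> 'rV[R]_n) a b t v L :
  a <= t -> t <= b -> locally_lipschitz_on setT U ->
  straddle a b c t v -> (clarke U (c t) v <= L%:E)%E ->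
  straddle_le a b (U \o c) t L.
Proof.
move=> at_ tb lU sc hc e e0.
have e20 : 0 < e / 2 by lra.
have [r1 r10 h1] := clarke_quotient_le hc e20.
have [k [B /nbhs_normP[rB /= rB0 hB] lip]] := lU (c t) I.
have v0 : 0 <= `|v| by [].
have k0 : 0 <= `|k| by [].
have K0 : 0 < e / (2 * (`|k| + 1)) by rewrite divr_gt0//; lra.
have [r2 r20 h2] := sc _ K0.
have m0 : 0 < Num.min r1 (rB / 2) by rewrite lt_min r10; lra.
have [r3 r30 h3] := straddle_continuous at_ tb sc m0.
(* This radius keeps the end of the straight step in the ball where [U] is Lipschitz. *)
have q0 : 0 < rB / (2 * (`|v| + 1)) by rewrite divr_gt0//; lra.
exists (Num.min r1 (Num.min r2 (Num.min r3 (rB / (2 * (`|v| + 1))))))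
  => [|s u as_ st tu ub]; first by rewrite !lt_min r10 r20 r30.
rewrite !lt_min => /and4P[us1 us2 us3 us4] /=.
have [->|su] := eqVneq s u; first by rewrite !subrr mulr0.
have us0 : 0 < u - s.
  by rewrite subr_gt0 lt_neqAle su; lra.
have [cs1 csB] : `|c s - c t| < r1 /\ `|c s - c t| < rB / 2.
  by apply/andP; rewrite -lt_min; apply: h3; rewrite ?ltr_norml; lra.
have [_ cuB] : `|c u - c t| < r1 /\ `|c u - c t| < rB / 2.
  by apply/andP; rewrite -lt_min; apply: h3; rewrite ?ltr_norml; lra.
have Q1 := h1 (c s) (u - s) cs1 us0 us1.
have hv : (u - s) * `|v| <= rB / 2.
  have : (u - s) * (`|v| + 1) < rB / 2.
    by move: us4; rewrite ltr_pdivlMr; lra.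
  by lra.
have Bu : B (c u) by apply: hB => /=; rewrite distrC; lra.
have Bs : B (c s + (u - s) *: v).
  apply: hB => /=; rewrite distrC addrAC.
  by apply: le_lt_trans (ler_normD _ _) _; rewrite normrZ (ger0_norm (ltW us0)); lra.
have /= Q2 := lip (c u, c s + (u - s) *: v) (conj (conj I Bu) (conj I Bs)).
have Q3 := h2 s u as_ st tu ub us2.
have : k * `|c u - (c s + (u - s) *: v)| <= e / 2 * (u - s).
  rewrite opprD addrA; apply: le_trans (_ : `|k| * _ <= _);
    first by apply: ler_wpM2r => //; exact: ler_norm.
  apply: le_trans (ler_wpM2l k0 Q3) _; rewrite mulrA ler_wpM2r//; first exact: ltW.
  have -> : e / (2 * (`|k| + 1)) = (e / 2) / (`|k| + 1) by field; lra.
  by rewrite mulrCA ger_pMr// ler_pdivrMr; lra.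
have := ler_norm (U (c u) - U (c s + (u - s) *: v)).
by lra.
Qed.

Lemma diff_dot_grad n (f : 'rV[R]_n -> R) z v :
  differentiable f z -> 'd f z v = dot (grad f z) v.
Proof.
move=> df; rewrite {1}(row_sum_delta v) linear_sum /=; apply: eq_bigr => i _.
by rewrite linearZ /= mxE deriveE// mulrC.
Qed.

Lemma dot_le_norm n (u v : 'rV[R]_n) : `|dot u v| <= (\sum_i `|u 0 i|) * `|v|.
Proof.
rewrite mulr_suml; apply: le_trans (ler_norm_sum _ _ _) _.
by apply: ler_sum => i _; rewrite normrM ler_wpM2l// rV_coord_norm.
Qed.

Lemma straddle_differentiable n (f : 'rV[R]_n -> R) (c : R -> 'rV[R]_n) a b t v :
  a <= t -> t <= b -> differentiable f (c t) -> straddle a b c t v ->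
  straddle a b (f \o c) t (dot (grad f (c t)) v).
Proof.
move=> at_ tb df sc e e0.
set G := \sum_i `|grad f (c t) 0 i|.
have G0 : 0 <= G by apply: sumr_ge0.
have v0 : 0 <= `|v| by [].
pose e1 := e / 2 / (1 + `|v|); pose e2 := e / 2 / (1 + G).
have e10 : 0 < e1 by rewrite divr_gt0//; lra.
have e20 : 0 < e2 by rewrite divr_gt0//; lra.
have [r1 r10 h1] : exists2 r : R, 0 < r & forall y, `|y - c t| < r ->
    `|f y - f (c t) - dot (grad f (c t)) (y - c t)| <= e1 * `|y - c t|.
  have hd := (eqaddoP _ _ _ _).1 (diff_locally df).
  have /nbhs_normP[r /= r0 hr] := hd _ e10; exists r => // y yr.
  have := hr (y - c t); rewrite /= sub0r normrN => /(_ yr).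
  by rewrite !fctE /= subrK diff_dot_grad// opprD addrA.
have [r2 r20 h2] := sc e2 e20.
have [r3 r30 h3] := straddle_lip at_ tb sc.
have [r4 r40 h4] := straddle_continuous at_ tb sc r10.
exists (Num.min r2 (Num.min r3 r4)) => [|s u as_ st tu ub].
  by rewrite !lt_min r20 r30.
rewrite !lt_min => /and3P[us2 us3 us4] /=.
have dotB x y : dot (grad f (c t)) (x - y) = dot (grad f (c t)) x - dot (grad f
  (c t)) y.
  by rewrite -!diff_dot_grad// linearB.
have dotZ h x : dot (grad f (c t)) (h *: x) = h * dot (grad f (c t)) x.
  by rewrite -!diff_dot_grad// linearZ.
have main x : a <= x -> x <= b -> `|x - t| < r3 -> `|x - t| < r4 ->
    `|f (c x) - f (c t) - dot (grad f (c t)) (c x - c t)| <= e / 2 * `|x - t|.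
  move=> ax xb x3 x4; apply: le_trans (h1 _ (h4 x ax xb x4)) _.
  apply: le_trans (ler_wpM2l (ltW e10) (h3 x ax xb x3)) _.
  by rewrite mulrA /e1 divfK//; lra.
have us' : `|u - t| < r3 /\ `|u - t| < r4 by rewrite !ltr_norml; lra.
have ss' : `|s - t| < r3 /\ `|s - t| < r4 by rewrite !ltr_norml; lra.
have Mu := main u ltac:(lra) ub us'.1 us'.2.
have Ms := main s as_ ltac:(lra) ss'.1 ss'.2.
rewrite (ger0_norm (_ : 0 <= u - t)) in Mu; last lra.
rewrite (ler0_norm (_ : s - t <= 0)) in Ms; last lra.
have D : `|dot (grad f (c t)) (c u - c s - (u - s) *: v)| <= e / 2 * (u - s).
  apply: le_trans (dot_le_norm _ _) _.
  apply: le_trans (ler_wpM2l G0 (h2 s u as_ st tu ub us2)) _.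
  rewrite mulrA ler_wpM2r//; first lra.
  by rewrite /e2 mulrCA ger_pMr ?ler_pdivrMr; lra.
move: Mu Ms D; rewrite /GRing.scale /= !dotB dotZ !ler_norml => *; lra.
Qed.

End StraddleCalculus.

(** * Hybrid time domains *)

Section HybridTimeDomains.
Context {R : realType}.
Variable E : set (R * nat).
Hypothesis hE : hybrid_time_domain E.

(* [E] itself need not be totally ordered: only its truncations are compact
   hybrid time domains. *)

Lemma hybrid_time_domain_below t j : E (t, j) -> exists tj : nat -> R,
  [/\ forall k l, (k <= l)%N -> (l <= j)%N -> tj k <= tj l, tj j <= t
    & forall k s, (k <= j)%N -> s <= t -> E (s, k) <-> tj k <= s <= tj k.+1].
Proof.
move=> Etj; have [E0 EC] := hE; have [J [tj [tj0 tjS EE]]] := EC t j Etj.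
have inE' s k : (k <= j)%N -> s <= t -> E (s, k) <-> (k <= J)%N /\ tj k <= s <= tj k.+1.
  move=> kj st; split=> [Esk|h].
    have : (E `&` [set p | 0 <= p.1 <= t /\ (p.2 <= j)%N]) (s, k).
      by split=> //=; rewrite (E0 _ _ Esk) st.
    by rewrite EE.
  have : [set p | (p.2 <= J)%N /\ tj p.2 <= p.1 <= tj p.2.+1] (s, k) by [].
  by rewrite -EE => -[].
have [jJ /andP[jt _]] := (inE' t j (leqnn _) (lexx _)).1 Etj.
exists tj; split=> //.
  move=> k l kl lj; elim: l kl lj => [|l IH]; first by rewrite leqn0 => /eqP->.
  rewrite leq_eqVlt => /predU1P[->//|kl lj].
  apply: le_trans (IH kl (ltnW lj)) (tjS _ _).
  exact: leq_trans (ltnW lj) jJ.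
move=> k s kj st; rewrite inE'//; split=> [[]//|h]; split=> //.
exact: leq_trans kj jJ.
Qed.

Lemma hybrid_time_domain_itv s r t j : E (s, j) -> E (t, j) ->
  s <= r -> r <= t -> E (r, j).
Proof.
move=> Es Et sr rt; have [tj [_ _ h]] := hybrid_time_domain_below Et.
have /andP[? _] := (h j s (leqnn _) (le_trans sr rt)).1 Es.
have /andP[_ ?] := (h j t (leqnn _) (lexx _)).1 Et.
by apply/(h j r (leqnn _) rt); lra.
Qed.

(** Peels off the last jump before [(t, j.+1)], the step of every induction on the number of
    jumps. *)
Lemma hybrid_time_domain_jump s i t j : E (s, i) -> E (t, j.+1) ->
  s <= t -> (i <= j)%N ->
  exists r, [/\ s <= r, r <= t, E (r, j) & E (r, j.+1)].
Proof.
move=> Es Et st ij; have [tj [tjle tjt h]] := hybrid_time_domain_below Et.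
have /andP[_ s1] := (h i s (leqW ij) st).1 Es.
have /andP[_ t1] := (h j.+1 t (leqnn _) (lexx _)).1 Et.
exists (tj j.+1); split=> //.
- by apply: le_trans s1 (tjle _ _ _ _).
- by apply/h => //; rewrite lexx tjle.
- by apply/h => //; rewrite lexx /=; lra.
Qed.

End HybridTimeDomains.

(** * Estimates on a single flow interval *)

Section FlowEstimates.
Context {R : realType}.

(** The maximum [U] is nonincreasing, so [c (U b) <= c (U t) <= psi (U t)]: its slope is bounded by
    the constant [- c (U b)], and the mean value inequality replaces a comparison with a
    differential equation. *)
Lemma flow_decay (v eta v' eta' psi c : R -> R) (a b M : R) : a <= b ->
  (forall t, a <= t -> t <= b -> straddle a b v t (v' t)) ->
  (forall t, a <= t -> t <= b -> straddle a b eta t (eta' t)) ->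
  (forall t, a <= t -> t <= b -> 0 <= eta t) ->
  (forall t, a <= t -> t <= b -> eta t <= v t -> v' t <= - psi (v t)) ->
  (forall t, a <= t -> t <= b -> v t <= eta t -> eta' t <= - psi (eta t)) ->
  (forall u, 0 <= u -> 0 <= psi u) ->
  (forall u w, u <= w -> c u <= c w) ->
  (forall u, 0 <= u -> u <= M -> c u <= psi u) ->
  Num.max (v a) (eta a) <= M ->
  Num.max (v b) (eta b) <= Num.max (v a) (eta a) /\
  Num.max (v b) (eta b) + (b - a) * c (Num.max (v b) (eta b)) <=
    Num.max (v a) (eta a).
Proof.
move=> ab sv seta eta0 hv heta psi0 cle cpsi UM.
pose U t := Num.max (v t) (eta t).
have U0 t : a <= t -> t <= b -> 0 <= U t.
  by move=> at_ tb; rewrite le_max (eta0 t at_ tb) orbT.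
have sU t : a <= t -> t <= b -> straddle_le a b U t (- psi (U t)).
  move=> at_ tb; apply: straddle_le_max => //.
  - exact: straddle_continuous (sv t at_ tb).
  - exact: straddle_continuous (seta t at_ tb).
  - move=> h; rewrite /U max_l//.
    apply: straddle_le_weaken (hv t at_ tb h) _.
    by apply: straddle_straddle_le; exact: sv.
  - move=> h; rewrite /U max_r//.
    apply: straddle_le_weaken (heta t at_ tb h) _.
    by apply: straddle_straddle_le; exact: seta.
have sub s t x k : a <= s -> t <= b -> straddle_le a b U x k -> straddle_le s t U x k.
  move=> as_ tb h e e0; have [r r0 hr] := h e e0; exists r => // y z *.
  by apply: hr => //; lra.
have mono s t : a <= s -> s <= t -> t <= b -> U t <= U s.
  move=> as_ st tb; have : U t - U s <= 0 * (t - s).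
    apply: straddle_le_incr => // x sx xt;
      apply: (@straddle_le_weaken _ _ _ _ _ (- psi (U x))).
      by rewrite oppr_le0 psi0// U0//; lra.
    by apply: sub => //; apply: sU; lra.
  by rewrite mul0r subr_le0.
split; first exact: mono.
have : U b - U a <= - c (U b) * (b - a).
  apply: straddle_le_incr => // t at_ tb; apply: straddle_le_weaken (sU t at_ tb).
  rewrite lerN2; apply: le_trans (cle _ _ (mono t b at_ tb (lexx _))) _.
  apply: cpsi; first exact: U0.
  exact: le_trans (mono a t (lexx _) at_ tb) UM.
by rewrite -/(U b) -/(U a); lra.
Qed.

Lemma flow_gap (eta G eta' : R -> R) (a b g k l r : R) : a <= b -> 0 < g ->
  (forall t, a <= t -> t <= b -> straddle a b eta t (eta' t)) ->
  (forall t, a <= t -> t <= b -> - (l * g) <= eta' t) ->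
  (forall t, a <= t -> t <= b -> straddle_le a b G t (k * g)) ->
  eta a = g -> G a <= r * g -> eta b <= G b -> 1 - r <= (k + l) * (b - a).
Proof.
move=> ab g0 seta heta sG etaa Ga etab.
have H1 : G b - G a <= k * g * (b - a) by exact: straddle_le_incr.
have H2 : - eta b - - eta a <= l * g * (b - a).
  apply: (@straddle_le_incr _ _ _ (fun t => - eta t)) => // t at_ tb.
  apply: (@straddle_le_weaken _ _ _ _ _ (- eta' t)); first by rewrite lerNl heta.
  apply: straddle_straddle_le; apply: straddle_contract (seta t at_ tb) => y z.
  by rewrite scalerN -!opprD normrN.
by rewrite -(ler_pM2r g0); lra.
Qed.

End FlowEstimates.

(** * Regularity of the solutions during flows *)

Section NCSSolutions.
Context {R : realType} {nP nC nu : nat}.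
Local Notation nx := (nP + nC)%N.
Local Notation ne := (nP + nu)%N.

Lemma norm_lsubmx m n (u : 'rV[R]_(m + n)) : `|lsubmx u| <= `|u|.
Proof.
apply: rV_norm_le => // i; apply: le_trans (rV_coord_norm _ (lshift n i)).
by rewrite mxE.
Qed.

Lemma norm_rsubmx m n (u : 'rV[R]_(m + n)) : `|rsubmx u| <= `|u|.
Proof.
apply: rV_norm_le => // i; apply: le_trans (rV_coord_norm _ (rshift m i)).
by rewrite mxE.
Qed.

Definition proj_x (u : 'rV[R]_(nx + ne + 2)) : 'rV[R]_nx := lsubmx (lsubmx u).
Definition proj_e (u : 'rV[R]_(nx + ne + 2)) : 'rV[R]_ne := rsubmx (lsubmx u).
Definition proj_kappa (u : 'rV[R]_(nx + ne + 2)) : R :=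
  (lsubmx (rsubmx u : 'rV[R]_(1 + 1))) 0 0.
Definition proj_eta (u : 'rV[R]_(nx + ne + 2)) : R :=
  (rsubmx (rsubmx u : 'rV[R]_(1 + 1))) 0 0.

(** What it takes to pass absolute continuity and slopes from the state to its components; block
    projections qualify for the max norm. *)
Definition linear_contraction (U V : normedModType R) (L : U -> V) :=
  [/\ forall u v, L (u - v) = L u - L v, forall h u, L (h *: u) = h *: L u
    & forall u, `|L u| <= `|u|].

Lemma proj_x_contraction : linear_contraction proj_x.
Proof.
split=> [u v|h u|u]; rewrite /proj_x ?linearB ?linearZ//.
exact: le_trans (norm_lsubmx _) (norm_lsubmx _).
Qed.

Lemma proj_e_contraction : linear_contraction proj_e.
Proof.
split=> [u v|h u|u]; rewrite /proj_e ?linearB ?linearZ//.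
exact: le_trans (norm_rsubmx _) (norm_lsubmx _).
Qed.

Lemma proj_kappa_contraction : linear_contraction proj_kappa.
Proof.
split=> [u v|h u|u]; rewrite /proj_kappa ?mxE//.
by apply: le_trans (rV_coord_norm _ _).
Qed.

Lemma proj_eta_contraction : linear_contraction proj_eta.
Proof.
split=> [u v|h u|u]; rewrite /proj_eta ?mxE//.
by apply: le_trans (rV_coord_norm _ _).
Qed.

Lemma proj_xE (q : ncs_state R nP nC nu) : proj_x (ncs_coords q) = q_x q.
Proof. by rewrite /proj_x !row_mxKl. Qed.

Lemma proj_eE (q : ncs_state R nP nC nu) : proj_e (ncs_coords q) = q_e q.
Proof. by rewrite /proj_e row_mxKl row_mxKr. Qed.

Lemma proj_kappaE (q : ncs_state R nP nC nu) :
  proj_kappa (ncs_coords q) = (q_kappa q)%:R.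
Proof. by rewrite /proj_kappa row_mxKr (@row_mxKl _ 1 1 1) mxE eqxx mulr1n. Qed.

Lemma proj_etaE (q : ncs_state R nP nC nu) : proj_eta (ncs_coords q) = q_eta q.
Proof. by rewrite /proj_eta row_mxKr (@row_mxKr _ 1 1 1) mxE eqxx mulr1n. Qed.

Lemma straddle_linear_contraction (U V : normedModType R) (L : U -> V) a b t
    (c : R -> U) v : linear_contraction L ->
  straddle a b c t v -> straddle a b (L \o c) t (L v).
Proof.
by move=> [LB LZ Lle]; apply: straddle_contract => s u; rewrite /= -LZ -!LB.
Qed.

Lemma abs_continuous_linear_contraction (U V : normedModType R) (L : U -> V) a b
    (c : R -> U) : linear_contraction L ->
  abs_continuous a b c -> abs_continuous a b (L \o c).
Proof.
by move=> [LB LZ Lle]; apply: abs_continuous_contract => s u; rewrite /= -!LB.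
Qed.

Lemma linear_contraction_continuous (U V : normedModType R) (L : U -> V) :
  linear_contraction L -> continuous L.
Proof.
move=> [LB _ Lle] x; apply/cvgrPdist_lt => e e0; apply/nbhs_normP.
by exists e => // y /= xy; rewrite -LB; apply: le_lt_trans xy.
Qed.

Lemma within_continuous_pair (U V W : normedModType R) (A : set U)
    (f : U -> V) (g : U -> W) :
  {within A, continuous f} -> {within A, continuous g} ->
  {within A, continuous (fun u => (f u, g u))}.
Proof.
move=> /within_continuousP cf /within_continuousP cg.
apply/within_continuousP => x Ax e e0.
have [d d0 hd] := cf x Ax e e0; have [d' d'0 hd'] := cg x Ax e e0.
exists (Num.min d d') => [|y Ay]; first by rewrite lt_min d0.
by rewrite lt_min => /andP[h1 h2]; rewrite prod_normE /= gt_max hd// hd'.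
Qed.

Variables (S : ncs R nP nC nu) (delta gtilde : R -> R)
  (V : 'rV[R]_nx -> R) (W : R -> 'rV[R]_ne -> R).
Hypotheses (hfx : continuous (fun z : 'rV[R]_nx * 'rV[R]_ne => fx S z.1 z.2))
  (hfe : continuous (fun z : 'rV[R]_nx * 'rV[R]_ne => fe S z.1 z.2))
  (hdelta : {within nonneg, continuous (fun eta : R => - delta eta)})
  (hC : closed (@ncs_coords R nP nC nu @` ncs_flow_set gtilde V W)).

Local Notation H := (ncs_system S delta gtilde V W).
Variables (dom : set (R * nat)) (phi : R -> nat -> ncs_state R nP nC nu).
Hypothesis sol : @is_solution R _ H dom phi.

Variables (j : nat) (a b : R).
Hypotheses (ab : a < b) (domab : forall t, a <= t -> t <= b -> dom (t, j)).

Let curve t : 'rV[R]_(nx + ne + 2) := ncs_coords (phi t j).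

Lemma solution_interior t : a < t < b -> ([set s | dom (s, j)])° t.
Proof.
move=> /andP[at_ tb]; apply/nbhs_normP.
exists (Num.min (t - a) (b - t)) => [|s /=]; first by rewrite /= lt_min !subr_gt0 at_.
by rewrite lt_min !ltr_norml => /andP[? ?]; apply: domab; lra.
Qed.

Lemma solution_curve_abs_continuous : abs_continuous a b curve.
Proof.
apply: (sol_abs_continuous sol (j := j)); first exact: ltW.
by move=> t /=; rewrite in_itv /= => /andP[]; exact: domab.
Qed.

(** Solutions are required to be in C only at interior times; the ends of the interval are limits of
    such times, and C is closed. *)
Lemma solution_flow_set t : a <= t -> t <= b ->
  ncs_flow_set gtilde V W (phi t j).
Proof.
move=> at_ tb.
have hin s : a < s < b -> ncs_flow_set gtilde V W (phi s j).
  by move=> /solution_interior; exact: (sol_flow_set sol).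
have /within_continuousP cc := abs_continuous_continuous solution_curve_abs_continuous.
suff [q qC /ncs_coords_inj <-//] : (@ncs_coords R nP nC nu @` ncs_flow_set
  gtilde V W) (curve t).
apply: hC => B /nbhs_normP[r /= r0 hr].
have tab : `[a, b]%classic t by rewrite /= in_itv /= at_.
have [d d0 hd] := cc t tab r r0.
have [s [sab st]] : exists s, a < s < b /\ `|s - t| < d.
  pose m := Num.min d (b - a) / 2.
  have m0 : 0 < Num.min d (b - a) by rewrite lt_min d0 subr_gt0.
  have m1 : Num.min d (b - a) <= d by rewrite ge_min lexx.
  have m2 : Num.min d (b - a) <= b - a by rewrite ge_min lexx orbT.
  have [ta|ta] := eqVneq t a.
    by exists (a + m); rewrite ta ltr_norml /m; split; lra.
  have [tb'|tb'] := eqVneq t b.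
    by exists (b - m); rewrite tb' ltr_norml /m; split; lra.
  exists t; split; last by rewrite subrr normr0.
  by rewrite !lt_neqAle at_ tb tb' eq_sym ta.
exists (curve s); split; first by exists (phi s j) => //; exact: hin.
apply: hr => /=; rewrite distrC; apply: hd => //.
by rewrite /= in_itv /=; lra.
Qed.

Lemma solution_ae_straddle : {ae @lebesgue_measure R, forall t, a < t < b ->
  straddle a b curve t (ncs_flow_map S delta (phi t j))}.
Proof.
apply: ae_lebesgueS (sol_flow sol j) => t h /solution_interior/h.
exact: is_derive_straddle.
Qed.

Let flow_mapE q : [/\ proj_x (ncs_flow_map S delta q) = fx S (q_x q) (q_e q),
  proj_e (ncs_flow_map S delta q) = fe S (q_x q) (q_e q),
  proj_kappa (ncs_flow_map S delta q) = 0
  & proj_eta (ncs_flow_map S delta q) = - delta (q_eta q)].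
Proof.
rewrite /proj_x /proj_e /proj_kappa /proj_eta /ncs_flow_map !row_mxKl !row_mxKr.
split; rewrite ?(@row_mxKl _ 1 1 1) ?(@row_mxKr _ 1 1 1) ?row_mxKr//.
  by rewrite mxE.
by rewrite mxE eqxx mulr1n.
Qed.

Let ae_proj (U : normedModType R) (L : _ -> U) : linear_contraction L ->
  {ae @lebesgue_measure R, forall t, a < t < b ->
    straddle a b (L \o curve) t (L (ncs_flow_map S delta (phi t j)))}.
Proof.
move=> hL; apply: ae_lebesgueS solution_ae_straddle => t h /h.
exact: straddle_linear_contraction.
Qed.

Let within_proj (U : normedModType R) (L : _ -> U) : linear_contraction L ->
  {within `[a, b], continuous (L \o curve)}.
Proof.
move=> hL; apply: abs_continuous_continuous.
by apply: abs_continuous_linear_contraction => //; exact: solution_curve_abs_continuous.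
Qed.

Let within_xe : {within `[a, b], continuous (fun t => (q_x (phi t j), q_e (phi t j)))}.
Proof.
have := within_continuous_pair (within_proj proj_x_contraction) (within_proj
  proj_e_contraction).
rewrite (_ : (fun u => _) = (fun t => (q_x (phi t j), q_e (phi t j))))//.
by apply/funext => t; rewrite /= /curve proj_xE proj_eE.
Qed.

Let within_xe_comp (U : normedModType R) (F : 'rV[R]_nx * 'rV[R]_ne -> U) :
  continuous F ->
  {within `[a, b], continuous (fun t => F (q_x (phi t j), q_e (phi t j)))}.
Proof.
move=> cF.
apply: (@within_continuous_within_comp _ _ _ _ _ setT _ F _ within_xe) => //.
exact: continuous_subspaceT.
Qed.

Lemma solution_straddle_x t : a <= t -> t <= b ->
  straddle a b (fun s => q_x (phi s j)) t (fx S (q_x (phi t j)) (q_e (phi t j))).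
Proof.
have cE : proj_x \o curve = (fun s => q_x (phi s j)).
  by apply/funext => s; rewrite /= /curve proj_xE.
move=> at_ tb; rewrite -cE.
apply: (@ae_derive_straddle_rV _ _ _ (fun t => fx S (q_x (phi t j)) (q_e (phi t j)))).
- by apply: abs_continuous_linear_contraction proj_x_contraction _;
    exact: solution_curve_abs_continuous.
- apply: ae_lebesgueS (ae_proj proj_x_contraction) => s h /h.
  by have [-> _ _ _] := flow_mapE (phi s j).
- exact: (within_xe_comp hfx).
- by rewrite at_.
Qed.

Lemma solution_straddle_e t : a <= t -> t <= b ->
  straddle a b (fun s => q_e (phi s j)) t (fe S (q_x (phi t j)) (q_e (phi t j))).
Proof.
have cE : proj_e \o curve = (fun s => q_e (phi s j)).
  by apply/funext => s; rewrite /= /curve proj_eE.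
move=> at_ tb; rewrite -cE.
apply: (@ae_derive_straddle_rV _ _ _ (fun t => fe S (q_x (phi t j)) (q_e (phi t j)))).
- by apply: abs_continuous_linear_contraction proj_e_contraction _;
    exact: solution_curve_abs_continuous.
- apply: ae_lebesgueS (ae_proj proj_e_contraction) => s h /h.
  by have [_ -> _ _] := flow_mapE (phi s j).
- exact: (within_xe_comp hfe).
- by rewrite at_.
Qed.

Lemma solution_straddle_eta t : a <= t -> t <= b ->
  straddle a b (fun s => q_eta (phi s j)) t (- delta (q_eta (phi t j))).
Proof.
have cE : proj_eta \o curve = (fun s => q_eta (phi s j)).
  by apply/funext => s; rewrite /= /curve proj_etaE.
move=> at_ tb; rewrite -cE.
apply: (@ae_derive_straddle _ _ (fun t => - delta (q_eta (phi t j)))).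
- by apply: abs_continuous_linear_contraction proj_eta_contraction _;
    exact: solution_curve_abs_continuous.
- apply: ae_lebesgueS (ae_proj proj_eta_contraction) => s h /h.
  by have [_ _ _ ->] := flow_mapE (phi s j).
- have := within_proj proj_eta_contraction; rewrite cE => ceta.
  (* Continuity of [delta] is known on the half-line only; membership in the flow set, ends
     included, keeps [eta] there. *)
  apply: (@within_continuous_within_comp _ _ _ _ _ nonneg _ (fun h => - delta
    h) _ ceta) => //.
  by move=> s /=; rewrite in_itv /= => /andP[as_ sb];
    have [] := solution_flow_set as_ sb.
- by rewrite at_.
Qed.

(** As a real coordinate the counter is absolutely continuous with zero derivative. Its constancy
    reduces [gtildeW] to a function of e alone, as the Clarke derivative with fixed counter
    demands. *)
Lemma solution_kappa t : a <= t -> t <= b -> q_kappa (phi t j) = q_kappa (phi a j).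
Proof.
move=> at_ tb.
have kle (g : R -> R) : abs_continuous a b g ->
    {ae @lebesgue_measure R, forall s, a < s < b -> straddle a b g s 0} -> g t = g a.
  move=> gac gae.
  have h s : a <= s -> s <= t -> straddle a t g s 0.
    move=> as_ st; apply: (straddle_sub (lexx a) tb).
    apply: (@ae_derive_straddle _ g (fun=> 0)) => //; last by lra.
    exact: cst_continuous.
  have h1 : g t - g a <= 0 * (t - a).
    by apply: straddle_le_incr => // s as_ st; apply: straddle_straddle_le; exact: h.
  have h2 : - g t - - g a <= 0 * (t - a).
    apply: (@straddle_le_incr _ _ _ (fun t => - g t)) => // s as_ st.
    apply: straddle_straddle_le; apply: straddle_contract (h s as_ st) => y z.
    by rewrite !scaler0 !subr0 -opprD normrN.
  by lra.
have := kle (proj_kappa \o curve).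
rewrite /= /curve !proj_kappaE => /(_ _ _)/eqP; rewrite eqr_nat => h; apply/eqP/h.
- by apply: abs_continuous_linear_contraction proj_kappa_contraction _;
    exact: solution_curve_abs_continuous.
- apply: ae_lebesgueS (ae_proj proj_kappa_contraction) => s h' /h'.
  by have [_ _ -> _] := flow_mapE (phi s j).
Qed.

End NCSSolutions.

(** * The Euclidean norm and its relation to the max norm *)

Section EuclideanNorm.
Context {R : realType}.

Lemma dot_ge0 n (u : 'rV[R]_n) : 0 <= dot u u.
Proof. by apply: sumr_ge0 => i _; rewrite -expr2 sqr_ge0. Qed.

Lemma enorm_ge0 n (u : 'rV[R]_n) : 0 <= enorm u.
Proof. exact: sqrtr_ge0. Qed.

Lemma dot_row_mx m n (u : 'rV[R]_m) (v : 'rV[R]_n) :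
  dot (row_mx u v) (row_mx u v) = dot u u + dot v v.
Proof.
rewrite /dot big_split_ord /=; congr (_ + _); apply: eq_bigr => i _.
  by rewrite row_mxEl.
by rewrite row_mxEr.
Qed.

Lemma enorm_row_mxl m n (u : 'rV[R]_m) (v : 'rV[R]_n) :
  enorm u <= enorm (row_mx u v).
Proof. by rewrite ler_wsqrtr// dot_row_mx lerDl dot_ge0. Qed.

Lemma enorm_row_mxr m n (u : 'rV[R]_m) (v : 'rV[R]_n) :
  enorm v <= enorm (row_mx u v).
Proof. by rewrite ler_wsqrtr// dot_row_mx lerDr dot_ge0. Qed.

Lemma enorm_row_mx_le m n (u : 'rV[R]_m) (v : 'rV[R]_n) :
  enorm (row_mx u v) <= enorm u + enorm v.
Proof.
rewrite -(ler_pXn2r (n := 2)) ?nnegrE ?addr_ge0 ?enorm_ge0//.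
rewrite {1}/enorm sqr_sqrtr ?dot_ge0// dot_row_mx sqrrD.
rewrite /enorm !sqr_sqrtr ?dot_ge0// -/(enorm u) -/(enorm v).
have := mulr_ge0 (enorm_ge0 u) (enorm_ge0 v); lra.
Qed.

Lemma norm_le_enorm n (u : 'rV[R]_n) : `|u| <= enorm u.
Proof.
apply: rV_norm_le => [|i]; first exact: enorm_ge0.
rewrite -sqrtr_sqr ler_wsqrtr// /dot (bigD1 i)//= expr2 lerDl.
by apply: sumr_ge0 => k _; rewrite -expr2 sqr_ge0.
Qed.

Lemma enorm_eq0 n (u : 'rV[R]_n) : enorm u <= 0 -> u = 0.
Proof. by move=> u0; apply/normr0_eq0/le_anti;
  rewrite normr_ge0 (le_trans (norm_le_enorm u)). Qed.

Lemma enorm0 n : enorm (0 : 'rV[R]_n) = 0.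
Proof. by rewrite /enorm /dot big1 ?sqrtr0// => i _; rewrite mxE mul0r. Qed.

Lemma enorm_scalar_mx (a : R) : enorm (a%:M : 'rV[R]_1) = `|a|.
Proof. by rewrite /enorm /dot big_ord1 !mxE eqxx mulr1n -expr2 sqrtr_sqr. Qed.

Lemma compact_norm_le n (r : R) : compact [set u : 'rV[R]_n | `|u| <= r].
Proof.
apply: bounded_closed_compact.
  exists r; split; first exact: num_real.
  by move=> M rM u /= ur; apply: le_trans ur (ltW rM).
by apply: (@closed_comp _ _ (fun u : 'rV[R]_n => `|u|) [set y | y <= r]);
  [move=> u _; exact: norm_continuous | exact: closed_le].
Qed.

End EuclideanNorm.

(** * Uniform constants for [delta] and for the contraction of the gain *)

Section GainLemmas.
Context {R : realType}.

(** Near 0 the Lipschitz constant serves as slope; beyond the radius [r],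
    [delta s <= delta M <= delta M / r * s]. *)
Lemma class_Koo_linear_bound (delta : R -> R) (M : R) : class_Koo delta ->
  locally_lipschitz_on nonneg delta ->
  exists2 l : R, 0 <= l & forall s, 0 <= s -> s <= M -> delta s <= l * s.
Proof.
move=> Kd lip; have [[_ d0 _] _] := Kd.
have [k [B /nbhs_normP[r /= r0 hB] hk]] := lip 0 (lexx _).
have near0 s : 0 <= s -> s < r -> delta s <= `|k| * s.
  move=> s0 sr; have Bs : B s by apply: hB; rewrite /= sub0r normrN ger0_norm.
  have B0 : B 0 by apply: hB; rewrite /= subrr normr0.
  have := hk (s, 0) (conj (conj s0 Bs) (conj (lexx 0) B0)).
  rewrite /= d0 !subr0 (ger0_norm s0) => H; apply: le_trans (ler_norm _) _.
  by apply: le_trans H _; rewrite ler_wpM2r// ler_norm.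
have [M0|M0] := ltrP M 0.
  by exists 0 => // s s0 sM; exfalso; lra.
have dM := class_K_ge0 Kd.1 M0.
exists (Num.max `|k| (delta M / r)) => [|s s0 sM]; first by rewrite le_max normr_ge0.
have [sr|rs] := ltrP s r.
  by apply: le_trans (near0 s s0 sr) _; rewrite ler_wpM2r// le_max lexx.
apply: le_trans (_ : delta M / r * s <= _); last first.
  by rewrite ler_wpM2r// le_max lexx orbT.
apply: le_trans (class_K_le Kd.1 s0 sM) _.
by rewrite mulrAC -mulrA ler_peMr// ler_pdivlMr// mul1r.
Qed.

(** The limit gives the ratio [(1 + eps) / 2] near 0. Away from 0, compactness gives a positive
    lower bound [d] for [gt s - gt (rho * s)], and [gt s <= M] turns it into the ratio
    [1 - d / M]. *)
Lemma contraction_ratio (gt : R -> R) (rho eps M : R) : class_Koo gt ->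
  0 <= rho < 1 -> eps < 1 -> 0 < M ->
  gt (rho * s) / gt s @[s --> 0^'+] --> eps ->
  exists2 r : R, r < 1 & forall s, 0 <= s -> gt s <= M -> gt (rho * s) <= r * gt s.
Proof.
move=> Kg /andP[rho0 rho1] eps1 M0 lim.
have [g0 gi gs] := (class_KooP gt).1 Kg.
have [s1 s10 gs1] := gs M (ltW M0).
have s1p : 0 < s1.
  by rewrite lt_neqAle s10 andbT; apply/eqP => E; move: M0; rewrite -gs1 -E g0 ltxx.
have p1 : eps < (1 + eps) / 2 by lra.
have [r0 r00 near0] : exists2 r0 : R, 0 < r0 & forall s, 0 < s -> s < r0 ->
    gt (rho * s) <= (1 + eps) / 2 * gt s.
  have e0 : 0 < (1 + eps) / 2 - eps by lra.
  have /cvgrPdist_lt/(_ _ e0) := lim.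
  rewrite near_withinE near_simpl => /nbhs_normP[r0 /= r00 h]; exists r0 => // s sp sr.
  have := h s; rewrite /= sub0r normrN (ger0_norm (ltW sp)) => /(_ sr sp).
  rewrite ltr_norml => /andP[hs _].
  by rewrite -ler_pdivrMr; [lra | exact: class_K_gt0 Kg.1 sp].
(* The interval from [w] to [s1] contains every [s >= r0] with [gt s <= M]; the minimum with [s1]
   keeps it nonempty. *)
pose w := Num.min (r0 / 2) s1.
have w0 : 0 < w by rewrite lt_min s1p andbT divr_gt0.
have ws1 : w <= s1 by rewrite ge_min lexx orbT.
have wr0 : w <= r0 / 2 by rewrite ge_min lexx.
have [[cg _ _] _] := Kg.
have cf : {within nonneg, continuous (fun s => gt s - gt (rho * s))}.
  apply: (within_continuousB cg).
  apply: (@within_continuous_within_comp _ _ _ _ nonneg nonneg (fun s => rho *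
    s) gt) => //.
    by move=> s /= s0; apply: mulr_ge0.
  apply: continuous_subspaceT => s.
  by apply: cvgM; [exact: cvg_cst|exact: cvg_id].
have [|m + hm] := EVT_min ws1 (f := fun s => gt s - gt (rho * s)).
  apply: continuous_subspaceW cf => s /=;
    rewrite in_itv /= /nonneg /= => /andP[? _]; lra.
rewrite in_itv /= => /andP[wm ms1].
set d := gt m - gt (rho * m) in hm.
have m0 : 0 < m by lra.
have d0 : 0 < d.
  by rewrite subr_gt0; apply: gi; [apply: mulr_ge0;
    lra | rewrite -[ltRHS]mul1r ltr_pM2r].
exists (Num.max ((1 + eps) / 2) (1 - d / M)) => [|s s0 sM].
  by rewrite gt_max ltrBlDr ltrDl divr_gt0// andbT; lra.
have gs0 := class_K_ge0 Kg.1 s0.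
have [->|sn0] := eqVneq s 0; first by rewrite mulr0 g0 mulr0.
have sp : 0 < s by rewrite lt_neqAle eq_sym sn0.
have [sr|rs] := ltrP s r0.
  by apply: le_trans (near0 s sp sr) _; rewrite ler_wpM2r// le_max lexx.
apply: le_trans (_ : (1 - d / M) * gt s <= _); last first.
  by rewrite ler_wpM2r// le_max lexx orbT.
have : d <= gt s - gt (rho * s).
  apply: hm; rewrite in_itv /=; apply/andP; split; first lra.
  by apply: (class_K_le_inv Kg.1) => //; rewrite gs1.
have : d / M * gt s <= d.
  by rewrite mulrAC -mulrA ger_pMr// ler_pdivrMr// mul1r.
by lra.
Qed.

End GainLemmas.

(** * The gain, the energy and its comparison bounds *)

Section NCSStability.
Context {R : realType} {nP nC nu : nat}.
Local Notation nx := (nP + nC)%N.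
Local Notation ne := (nP + nu)%N.

Variables (S : ncs R nP nC nu)
  (delta alphaV_lo alphaV_up alpha gamma alphaW_lo alphaW_up sigma gtilde : R -> R)
  (V : 'rV[R]_nx -> R) (W : R -> 'rV[R]_ne -> R) (rho : R).
Hypotheses
  (hfx : continuous (fun z : 'rV[R]_nx * 'rV[R]_ne => fx S z.1 z.2))
  (hfe : continuous (fun z : 'rV[R]_nx * 'rV[R]_ne => fe S z.1 z.2))
  (hdelta : class_Koo delta) (hdelta_lip : locally_lipschitz_on nonneg delta)
  (hC : closed (@ncs_coords R nP nC nu @` ncs_flow_set gtilde V W))
  (heta_flow : {within nonneg, continuous (fun eta : R => - delta eta)})
  (hV_diff : forall x, differentiable V x)
  (halphaV_lo : class_Koo alphaV_lo) (halphaV_up : class_Koo alphaV_up)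
  (halpha : class_Koo alpha) (hgamma : class_Koo gamma)
  (hV_bounds : forall x, alphaV_lo (enorm x) <= V x <= alphaV_up (enorm x))
  (hV_decr : forall x e,
     dot (grad V x) (fx S x e) <= - alpha (V x) + gamma (enorm e))
  (halphaW_lo : class_Koo alphaW_lo) (halphaW_up : class_Koo alphaW_up)
  (hrho : 0 <= rho < 1)
  (hW_bounds : forall (k : nat) e,
     alphaW_lo (enorm e) <= W k%:R e <= alphaW_up (enorm e))
  (hW_jump : forall (k : nat) e, W k.+1%:R (he S k e) <= rho * W k%:R e)
  (hsigma : class_Koo sigma) (hsigma_lt : forall s : R, 0 < s -> sigma s < s)
  (hgtilde : forall s : R, 0 <= s ->
     gtilde s = inv_nonneg alpha (inv_nonneg sigma (gamma (inv_nonneg alphaW_lo s))))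
  (hgtildeW_lip : forall k : nat,
     locally_lipschitz_on setT (gtildeW gtilde W k))
  (hclarke : forall K : set ('rV[R]_nx * 'rV[R]_ne), compact K ->
     exists2 L : R, 0 <= L & forall x e, K (x, e) -> forall k : nat,
       (clarke (gtildeW gtilde W k) e (fe S x e)
          <= (L * (V x + gtildeW gtilde W k e))%:E)%E)
  (hratio : exists2 eps : R, 0 <= eps < 1 &
     gtilde (rho * s) / gtilde s @[s --> 0^'+] --> eps).

Local Notation H := (ncs_system S delta gtilde V W).
Local Notation A := (target S delta gtilde V W).
Local Notation G := (gtildeW gtilde W).

Lemma gtilde_Koo : class_Koo gtilde.
Proof.
apply: class_Koo_eq (fun s s0 => esym (hgtilde s0)) _.
apply: (class_Koo_comp (class_Koo_inv halpha)).
apply: (class_Koo_comp (class_Koo_inv hsigma)).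
exact: (class_Koo_comp hgamma (class_Koo_inv halphaW_lo)).
Qed.

Lemma V_ge0 x : 0 <= V x.
Proof.
have /andP[h _] := hV_bounds x.
exact: le_trans (class_K_ge0 halphaV_lo.1 (enorm_ge0 x)) h.
Qed.

Lemma W_ge0 (k : nat) e : 0 <= W k%:R e.
Proof.
have /andP[h _] := hW_bounds k e.
exact: le_trans (class_K_ge0 halphaW_lo.1 (enorm_ge0 e)) h.
Qed.

Lemma gtildeW_ge0 k e : 0 <= G k e.
Proof. exact: class_K_ge0 gtilde_Koo.1 (W_ge0 k e). Qed.

(** This inequality explains the formula for [gtilde]: [sigma] after [alpha] cancels its two outer
    inverses, and what remains dominates [gamma (enorm e)] by the lower bound on W. *)
Lemma gamma_enorm_le k e : gamma (enorm e) <= sigma (alpha (G k e)).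
Proof.
have W0 := W_ge0 k e; rewrite /gtildeW hgtilde//.
have [i0 _] := inv_nonneg_spec halphaW_lo W0.
have g0 := class_K_ge0 hgamma.1 i0.
have [s0 sE] := inv_nonneg_spec hsigma g0.
have [_ ->] := inv_nonneg_spec halpha s0.
rewrite sE; apply: (class_K_le hgamma.1); first exact: enorm_ge0.
apply: inv_nonneg_le => //; first exact: enorm_ge0.
by have /andP[] := hW_bounds k e.
Qed.

(** A rate common to both branches of the energy: [delta] acts on [eta], and [alpha - sigma o alpha]
    is left for V once [gamma (enorm e) <= sigma (alpha (V x))]. It need not be monotone. *)
Definition decrease (s : R) := Num.min (delta s) (alpha s - sigma (alpha s)).

Lemma decrease_gt0 s : 0 < s -> 0 < decrease s.
Proof.
move=> s0; rewrite lt_min (class_K_gt0 hdelta.1 s0) subr_gt0.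
exact: hsigma_lt (class_K_gt0 halpha.1 s0).
Qed.

Lemma decrease0 : decrease 0 = 0.
Proof.
have [[_ d0 _] _] := hdelta; have [[_ a0 _] _] := halpha.
have [[_ s0 _] _] := hsigma.
by rewrite /decrease d0 a0 s0 subr0 minxx.
Qed.

Lemma decrease_ge0 s : 0 <= s -> 0 <= decrease s.
Proof.
rewrite le_eqVlt => /predU1P[<-|/decrease_gt0/ltW//]; by rewrite decrease0.
Qed.

Lemma decrease_continuous : {within nonneg, continuous decrease}.
Proof.
have [[cd _ _] _] := hdelta; have [[ca _ _] _] := halpha.
have [[csa _ _] _] := class_Koo_comp hsigma halpha.
have cB := within_continuousB ca csa.
by move=> s; exact: (continuous_min (cd s) (cB s)).
Qed.

Definition energy (q : ncs_state R nP nC nu) : R :=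
  Num.max (Num.max (V (q_x q)) (q_eta q)) (G (q_kappa q) (q_e q)).

Lemma energy_bounds q : [/\ V (q_x q) <= energy q, q_eta q <= energy q
  & G (q_kappa q) (q_e q) <= energy q].
Proof. by rewrite /energy; split; rewrite !le_max lexx ?orbT. Qed.

Lemma energy_ge0 q : 0 <= energy q.
Proof. by have [h _ _] := energy_bounds q; apply: le_trans (V_ge0 _) h. Qed.

Lemma energy_flow q : ncs_flow_set gtilde V W q ->
  energy q = Num.max (V (q_x q)) (q_eta q).
Proof. by move=> [h _]; rewrite /energy max_l. Qed.

Lemma gtildeW_jump k e : G k.+1 (he S k e) <= gtilde (rho * W k%:R e).
Proof. apply: (class_K_le gtilde_Koo.1) (W_ge0 _ _) (hW_jump k e). Qed.

(** On the jump set [gtildeW] is the largest term; the jump hands its value to [eta], leaves V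
    alone, and cannot increase [gtildeW] since [rho < 1]. *)
Lemma energy_jump q : ncs_jump_set gtilde V W q ->
  energy q = G (q_kappa q) (q_e q) /\
  energy (ncs_jump_map S gtilde W q) = G (q_kappa q) (q_e q).
Proof.
move=> [h _]; split; rewrite /energy; first by rewrite max_r.
move: h; rewrite ge_max => /andP[hV _] /=.
rewrite (max_r hV) max_l//; apply: le_trans (gtildeW_jump _ _) _.
apply: (class_K_le gtilde_Koo.1).
  by apply: mulr_ge0; [case/andP: hrho|exact: W_ge0].
by rewrite ler_piMl ?W_ge0//; case/andP: hrho => _ /ltW.
Qed.

Definition energy_up (s : R) := alphaV_up s + s + gtilde (alphaW_up s).

Lemma energy_up_Koo : class_Koo energy_up.
Proof.
apply: class_Koo_add; first by apply: class_Koo_add halphaV_up class_Koo_id.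
exact: class_Koo_comp gtilde_Koo halphaW_up.
Qed.

Definition dist_up (u : R) :=
  inv_nonneg alphaV_lo u + inv_nonneg (gtilde \o alphaW_lo) u + u.

Lemma dist_up_Koo : class_Koo dist_up.
Proof.
have K1 := class_Koo_inv halphaV_lo.
have K2 := class_Koo_inv (class_Koo_comp gtilde_Koo halphaW_lo).
exact: class_Koo_add (class_Koo_add K1 K2) class_Koo_id.
Qed.

Lemma enorm_x_le q : enorm (q_x q) <= inv_nonneg alphaV_lo (energy q).
Proof.
apply: inv_nonneg_le => //; [exact: enorm_ge0 | exact: energy_ge0 |].
have [h _ _] := energy_bounds q.
by have /andP[h' _] := hV_bounds (q_x q); apply: le_trans h' h.
Qed.

Lemma enorm_e_le q :
  enorm (q_e q) <= inv_nonneg (gtilde \o alphaW_lo) (energy q).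
Proof.
apply: inv_nonneg_le; [|exact: enorm_ge0 | exact: energy_ge0 |].
  exact: class_Koo_comp gtilde_Koo halphaW_lo.
have [_ _ h] := energy_bounds q; apply: le_trans h => /=.
apply: (class_K_le gtilde_Koo.1).
  exact: class_K_ge0 halphaW_lo.1 (enorm_ge0 _).
by have /andP[] := hW_bounds (q_kappa q) (q_e q).
Qed.

Lemma energy_le_dist (q : ncs_state R nP nC nu) :
  0 <= q_eta q -> energy q <= energy_up (@set_dist _ _ H A q).
Proof.
move=> eta0; rewrite set_dist_target /energy_up.
set d := enorm _.
have dx : enorm (q_x q) <= d.
  exact: le_trans (enorm_row_mxl _ (q_e q)) (enorm_row_mxl _ _).
have de : enorm (q_e q) <= d.
  exact: le_trans (enorm_row_mxr (q_x q) _) (enorm_row_mxl _ _).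
have deta : q_eta q <= d.
  rewrite -(ger0_norm eta0) -enorm_scalar_mx; exact: enorm_row_mxr.
have d0 : 0 <= d by apply: enorm_ge0.
have /andP[_ hV] := hV_bounds (q_x q).
have {}hV := le_trans hV (class_K_le halphaV_up.1 (enorm_ge0 _) dx).
have /andP[_ hW] := hW_bounds (q_kappa q) (q_e q).
have {}hW := le_trans hW (class_K_le halphaW_up.1 (enorm_ge0 _) de).
have hG : G (q_kappa q) (q_e q) <= gtilde (alphaW_up d).
  exact: class_K_le gtilde_Koo.1 (W_ge0 _ _) hW.
have := V_ge0 (q_x q); have := gtildeW_ge0 (q_kappa q) (q_e q) => *.
by rewrite /energy !ge_max -!andbA; apply/and3P; split; lra.
Qed.

Lemma dist_le_energy (q : ncs_state R nP nC nu) :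
  0 <= q_eta q -> @set_dist _ _ H A q <= dist_up (energy q).
Proof.
move=> eta0; rewrite set_dist_target /dist_up.
apply: le_trans (enorm_row_mx_le _ _) _; apply: lerD.
  apply: le_trans (enorm_row_mx_le _ _) _.
  by apply: lerD; [exact: enorm_x_le|exact: enorm_e_le].
by rewrite enorm_scalar_mx ger0_norm//; have [] := energy_bounds q.
Qed.

Lemma energy_target q : A q -> energy q = 0.
Proof.
move=> [qx qe qeta]; apply/le_anti; rewrite energy_ge0 andbT.
have [[_ u0 _] _] := energy_up_Koo.
have := @energy_le_dist q; rewrite qeta set_dist_target qx qe qeta.
rewrite (_ : _%:M = 0); last by rewrite raddf0.
by rewrite !row_mx0 enorm0 u0; exact.
Qed.

(** If it vanished, V and [eta], which lie below it on the jump set, would vanish too, and so would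
    e. The positive value is the scale divided out in the dwell time estimate. *)
Lemma gtildeW_gt0 q : ncs_jump_set gtilde V W q -> ~ A q ->
  0 < G (q_kappa q) (q_e q).
Proof.
move=> [h eta0] nA; rewrite lt_neqAle gtildeW_ge0 andbT; apply/eqP => G0.
move: h; rewrite -G0 ge_max => /andP[V0 eta0']; apply: nA; split.
- apply: enorm_eq0; apply: (class_K_le_inv halphaV_lo.1) => //.
  have [[_ -> _] _] := halphaV_lo.
  by have /andP[h _] := hV_bounds (q_x q); apply: le_trans V0.
- apply: enorm_eq0; have K := class_Koo_comp gtilde_Koo halphaW_lo.
  apply: (class_K_le_inv K.1) => //; have [[_ -> _] _] := K.
  rewrite G0; apply: (class_K_le gtilde_Koo.1).
    exact: class_K_ge0 halphaW_lo.1 (enorm_ge0 _).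
  by have /andP[] := hW_bounds (q_kappa q) (q_e q).
- by apply/le_anti; rewrite eta0 eta0'.
Qed.

Lemma closed_kernel (U U' : normedModType R) (L : U -> U') :
  linear_contraction L -> closed [set u | L u = 0].
Proof.
move=> /linear_contraction_continuous cL.
rewrite (_ : [set u | L u = 0] = (fun u => `|L u|) @^-1` [set y | y <= 0]).
  apply: closed_comp; last exact: closed_le.
  by move=> u _; apply: continuous_comp; [exact: cL|exact: norm_continuous].
by apply/seteqP; split=> u /=; [move=> ->; rewrite normr0 | rewrite normr_le0 => /eqP].
Qed.

(** The counter is free but integral, so zero conditions on x, e and [eta] do not describe the
    image. The closed image of C, which contains it, supplies the integrality. *)
Lemma closed_target : closed (coords H @` A).
Proof.
rewrite (_ : _ @` _ = (@ncs_coords R nP nC nu @` ncs_flow_set gtilde V W) `&`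
  ([set u | proj_x u = 0] `&` ([set u | proj_e u = 0] `&` [set u | proj_eta u = 0]))).
  apply: closedI => //.
  apply: closedI; first exact: closed_kernel proj_x_contraction.
  by apply: closedI; apply: closed_kernel;
    [exact: proj_e_contraction|exact: proj_eta_contraction].
apply/seteqP; split=> [_ [q qA <-]|_ [[q qC <-]]] /=.
  have E := energy_target qA; have [qx qe qeta] := qA.
  rewrite proj_xE proj_eE proj_etaE qx qe qeta; split=> //; exists q => //.
  split; last by rewrite qeta.
  by have [_ _] := energy_bounds q; rewrite E => /le_trans; apply; rewrite le_max V_ge0.
by rewrite proj_xE proj_eE proj_etaE => -[qx [qe qeta]]; exists q.
Qed.

(** * Decay of the energy along solutions *)

Definition decay_minorant (c : R -> R) (M : R) :=
  [/\ forall u, 0 <= u -> 0 <= c u, forall u v, u <= v -> c u <= c v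
    & forall u, 0 <= u -> u <= M -> c u <= decrease u].

Lemma solution_decay_itv (dom : set (R * nat)) (phi : R -> nat -> ncs_state R nP nC nu)
    (c : R -> R) (M : R) s t j : @is_solution _ _ H dom phi ->
  decay_minorant c M -> dom (s, j) -> dom (t, j) -> s <= t ->
  energy (phi s j) <= M ->
  energy (phi t j) <= energy (phi s j) /\
  energy (phi t j) + (t - s) * c (energy (phi t j)) <= energy (phi s j).
Proof.
(* A single time gives no information about the flow set, but the estimate is then trivial. *)
move=> sol [c0 cle cdec] ds dt; rewrite le_eqVlt => /predU1P[->|st] sM.
  by rewrite subrr mul0r addr0.
have domst (r : R) : s <= r -> r <= t -> dom (r, j).
  by move=> sr rt; exact: (hybrid_time_domain_itv (sol_domain sol) ds dt sr rt).
have flow r : s <= r -> r <= t -> ncs_flow_set gtilde V W (phi r j).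
  by move=> sr rt; exact: (solution_flow_set hC sol st domst sr rt).
have sV r : s <= r -> r <= t -> straddle s t (fun r => V (q_x (phi r j))) r
    (dot (grad V (q_x (phi r j))) (fx S (q_x (phi r j)) (q_e (phi r j)))).
  move=> sr rt; apply: (straddle_differentiable sr rt) => //.
  exact: (solution_straddle_x hfx sol st domst sr rt).
have seta r : s <= r -> r <= t -> straddle s t (fun r => q_eta (phi r j)) r
    (- delta (q_eta (phi r j))).
  by move=> sr rt; exact: (solution_straddle_eta heta_flow hC sol st domst sr rt).
have [Es Et] : energy (phi s j) = Num.max (V (q_x (phi s j))) (q_eta (phi s j)) /\
    energy (phi t j) = Num.max (V (q_x (phi t j))) (q_eta (phi t j)).
  by split; apply: energy_flow; apply: flow => //; exact: ltW.
rewrite Es Et in sM *.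
apply: (flow_decay (ltW st) sV seta _ _ _ decrease_ge0 cle cdec sM).
- by move=> r sr rt; have [] := flow r sr rt.
(* When V is the larger term, the flow set gives [gtildeW <= V], hence
   [gamma (enorm e) <= sigma (alpha V)]. *)
- move=> r sr rt etaV; apply: le_trans (hV_decr _ _) _.
  have [+ _] := flow r sr rt; rewrite (max_l etaV) => GV.
  have Ga := class_K_le halpha.1 (gtildeW_ge0 _ _) GV.
  have := class_K_le hsigma.1 (class_K_ge0 halpha.1 (gtildeW_ge0 _ _)) Ga.
  have := gamma_enorm_le (q_kappa (phi r j)) (q_e (phi r j)).
  have : decrease (V (q_x (phi r j))) <=
      alpha (V (q_x (phi r j))) - sigma (alpha (V (q_x (phi r j)))).
    by rewrite ge_min lexx orbT.
  by lra.
- by move=> r sr rt _; rewrite lerN2 ge_min lexx.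
Qed.

(** The estimates of successive intervals add up because the rate is taken at the final energy: it
    is a lower bound for the rate on every earlier interval. *)
Lemma solution_decay (dom : set (R * nat)) (phi : R -> nat -> ncs_state R nP nC nu)
    (c : R -> R) (M : R) s i t j : @is_solution _ _ H dom phi ->
  decay_minorant c M -> dom (s, i) -> dom (t, j) -> s <= t -> (i <= j)%N ->
  energy (phi s i) <= M ->
  energy (phi t j) <= energy (phi s i) /\
  energy (phi t j) + (t - s) * c (energy (phi t j)) <= energy (phi s i).
Proof.
move=> sol hc ds + + + sM; have [c0 cle cdec] := hc.
elim: j t => [|j IH] t dt st.
  rewrite leqn0 => /eqP i0; rewrite i0 in ds sM *.
  exact: solution_decay_itv sol hc ds dt st sM.
rewrite leq_eqVlt => /predU1P[ij|].
  by rewrite ij in ds sM *; exact: solution_decay_itv sol hc ds dt st sM.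
rewrite ltnS => ij.
have [r [sr rt dr dr1]] := hybrid_time_domain_jump (sol_domain sol) ds dt st ij.
have [H1 H2] := IH r dr sr ij.
have [Dr jmp] := sol_jump sol dr dr1.
have [E1 E2] := energy_jump Dr.
have Er : energy (phi r j.+1) = energy (phi r j) by rewrite jmp E1 -E2.
have [|H3 H4] := solution_decay_itv sol hc dr1 dt rt; first by rewrite Er; lra.
rewrite Er in H3 H4; split; first by lra.
have : (r - s) * c (energy (phi t j.+1)) <= (r - s) * c (energy (phi r j)).
  by apply: ler_wpM2l; [lra | exact: cle].
by lra.
Qed.

(** With the zero rate the decay lemma gives plain monotonicity of the energy. *)
Lemma decay_minorant0 M : decay_minorant (fun=> 0) M.
Proof. by split=> // u u0 _; exact: decrease_ge0. Qed.

(** The notion of solution does not place a final point reached by a jump in C or D; there the sign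
    comes from the reset value of [eta]. *)
Lemma solution_eta_ge0 (dom : set (R * nat)) (phi : R -> nat -> ncs_state R nP nC nu)
    t j : @is_solution _ _ H dom phi -> dom (t, j) -> 0 <= q_eta (phi t j).
Proof.
move=> sol dt.
have flow s : dom (s, j) -> s < t -> 0 <= q_eta (phi t j).
  move=> ds st.
  have domst (r : R) : s <= r -> r <= t -> dom (r, j).
    by move=> sr rt; exact: (hybrid_time_domain_itv (sol_domain sol) ds dt sr rt).
  by have [] := solution_flow_set hC sol st domst (ltW st) (lexx _).
have t0 : 0 <= t by have [h _] := sol_domain sol; exact: h dt.
have [d0 init] := sol_init sol.
case: j dt flow => [|j] dt flow.
  move: t0; rewrite le_eqVlt => /predU1P[<-|]; last exact: flow.
  by case: init => -[].
have [r [_ rt dr dr1]] := hybrid_time_domain_jump (sol_domain sol) d0 dt t0 (leq0n j).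
move: rt; rewrite le_eqVlt => /predU1P[<-|]; last exact: flow.
by have [_ ->] := sol_jump sol dr dr1; exact: gtildeW_ge0.
Qed.

(** * The dwell time *)

Lemma energy_sublevel_compact M : exists2 K : set ('rV[R]_nx * 'rV[R]_ne),
  compact K & forall q, energy q <= M -> K (q_x q, q_e q).
Proof.
have K1 := class_Koo_inv halphaV_lo.
have K2 := class_Koo_inv (class_Koo_comp gtilde_Koo halphaW_lo).
exists ([set x | `|x| <= inv_nonneg alphaV_lo M] `*`
        [set e | `|e| <= inv_nonneg (gtilde \o alphaW_lo) M]).
  by apply: compact_setX; exact: compact_norm_le.
move=> q qM; split=> /=; apply: le_trans (norm_le_enorm _) _.
  by apply: le_trans (enorm_x_le q) _; apply: (class_K_le K1.1) => //;
    exact: energy_ge0.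
by apply: le_trans (enorm_e_le q) _; apply: (class_K_le K2.1) => //; exact: energy_ge0.
Qed.

(* Just after a jump [eta] equals [g], the value of [gtildeW] before the jump,
   while [gtildeW] has dropped to at most [r * g] with [r < 1]. Both then move
   at a speed at most proportional to [g], so [gtildeW] needs a time independent
   of [g] to reach [eta] again. *)
Lemma successive_jumps_gap M : 0 < M -> exists2 tau : R, 0 < tau &
  forall (dom : set (R * nat)) (phi : R -> nat -> ncs_state R nP nC nu) a b j,
  @is_solution _ _ H dom phi -> dom (a, j) -> dom (a, j.+1) -> dom (b, j.+1) ->
  dom (b, j.+2) -> a <= b -> energy (phi a j) <= M -> ~ A (phi a j) ->
  tau <= b - a.
Proof.
move=> M0.
have [K cK hK] := energy_sublevel_compact M.
have [L L0 hL] := hclarke cK.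
have [l l0 hl] := class_Koo_linear_bound M hdelta hdelta_lip.
have [eps /andP[_ eps1] lim] := hratio.
have [r r1 hr] := contraction_ratio gtilde_Koo hrho eps1 M0 lim.
(* The Clarke bound [L * (V + gtildeW)] is at most [2 * L * g], as both terms stay below [g]; [l]
   bounds the descent of [eta], and 1 keeps the denominator positive. *)
exists ((1 - r) / (2 * L + l + 1)); first by rewrite divr_gt0//; lra.
move=> dom phi a b j sol da da1 db1 db2 ab aM nA.
have [Da jmp] := sol_jump sol da da1.
have [Db _] := sol_jump sol db1 db2.
have [E1 E2] := energy_jump Da.
set g := G _ _ in E1 E2.
have g0 : 0 < g by exact: gtildeW_gt0 Da nA.
have gM : g <= M by rewrite -E1.
have etaa : q_eta (phi a j.+1) = g by rewrite jmp.
have Ea : energy (phi a j.+1) = g by rewrite jmp.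
have Ga : G (q_kappa (phi a j.+1)) (q_e (phi a j.+1)) <= r * g.
  rewrite jmp; apply: le_trans (gtildeW_jump _ _) _.
  exact: hr (W_ge0 _ _) gM.
have etab : q_eta (phi b j.+1) <= G (q_kappa (phi b j.+1)) (q_e (phi b j.+1)).
  by have [+ _] := Db; rewrite ge_max => /andP[].
have rg : r * g < g by rewrite -[ltRHS]mul1r ltr_pM2r.
(* An immediate second jump would need [g <= r * g]. *)
move: ab; rewrite le_eqVlt => /predU1P[ab|ab].
  by exfalso; rewrite -ab etaa in etab; lra.
have domab t : a <= t -> t <= b -> dom (t, j.+1).
  by move=> at_ tb; exact: (hybrid_time_domain_itv (sol_domain sol) da1 db1 at_ tb).
have kE t : a <= t -> t <= b -> q_kappa (phi t j.+1) = q_kappa (phi a j.+1).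
  by move=> at_ tb; exact: (solution_kappa sol ab domab at_ tb).
set k := q_kappa (phi a j.+1) in Ga kE.
rewrite (kE b (ltW ab) (lexx b)) in etab.
have Eg t : a <= t -> t <= b -> energy (phi t j.+1) <= g.
  move=> at_ tb; rewrite -Ea.
  have aM' : energy (phi a j.+1) <= M by rewrite Ea.
  by have [] := solution_decay sol (decay_minorant0 M) da1 (domab t at_ tb) at_
    (leqnn _) aM'.
have : 1 - r <= (2 * L + l) * (b - a).
  apply: (@flow_gap _ (fun t => q_eta (phi t j.+1)) (G k \o (fun t => q_e (phi t j.+1)))
    (fun t => - delta (q_eta (phi t j.+1))) a b g (2 * L) l r (ltW ab) g0) => //.
  - by move=> t at_ tb; exact: (solution_straddle_eta heta_flow hC sol ab domab at_ tb).
  - move=> t at_ tb; rewrite lerN2.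
    have [_ eg _] := energy_bounds (phi t j.+1).
    have {}eg := le_trans eg (Eg t at_ tb).
    have eta0 := solution_eta_ge0 sol (domab t at_ tb).
    apply: le_trans (hl _ eta0 (le_trans eg gM)) _.
    exact: ler_wpM2l.
  - move=> t at_ tb; apply: (straddle_clarke at_ tb (hgtildeW_lip k)).
      exact: (solution_straddle_e hfe sol ab domab at_ tb).
    have [Vg _ Gg] := energy_bounds (phi t j.+1); rewrite kE// in Gg.
    have Kt := hK _ (le_trans (Eg t at_ tb) gM).
    apply: le_trans (hL _ _ Kt k) _; rewrite lee_fin -mulrA mulrCA ler_wpM2l//.
    by have := Eg t at_ tb; lra.
by rewrite ler_pdivrMr; lra.
Qed.

(** Between [n.+1] jumps there are [n] gaps, and the first jump may come at once after [s]; this is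
    the source of the added 1. *)
Lemma solution_dwell_time M tau (dom : set (R * nat))
    (phi : R -> nat -> ncs_state R nP nC nu) s i t j :
  @is_solution _ _ H dom phi -> 0 < tau ->
  (forall a b j, dom (a, j) -> dom (a, j.+1) -> dom (b, j.+1) -> dom (b, j.+2) ->
    a <= b -> energy (phi a j) <= M -> ~ A (phi a j) -> tau <= b - a) ->
  dom (s, i) -> dom (t, j) -> s <= t -> (i <= j)%N -> energy (phi s i) <= M ->
  (forall t' j', dom (t', j') -> s <= t' <= t -> (i <= j' <= j)%N ->
     ~ A (phi t' j')) ->
  j%:R - i%:R <= (t - s) / tau + 1.
Proof.
move=> sol tau0 gap ds dt st ij sM nA.
have {}nA t' j' : dom (t', j') -> s <= t' -> t' <= t -> (i <= j')%N ->
    (j' <= j)%N -> ~ A (phi t' j').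
  by move=> *; apply: nA => //; apply/andP.
have key n r : (i + n.+1 <= j)%N -> dom (r, (i + n.+1)%N) -> s <= r -> r <= t ->
    exists r', [/\ s <= r', r' <= r, dom (r', (i + n)%N),
      dom (r', (i + n.+1)%N) & n%:R * tau <= r' - s].
  elim: n r => [|n IH] r nj dr sr rt.
    rewrite addn1 in dr.
    have [r' [h1 h2 h3 h4]] := hybrid_time_domain_jump (sol_domain sol) ds dr
      sr (leqnn i).
    by exists r'; split; rewrite ?addn0 ?addn1// mul0r subr_ge0.
  rewrite addnS in dr nj.
  have [r2 [h1 h2 h3 h4]] := hybrid_time_domain_jump (sol_domain sol) ds dr sr
    (leq_addr n.+1 i).
  have [|r1 [h5 h6 h7 h8 h9]] := IH r2 (ltnW nj) h3 h1; first exact: le_trans rt.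
  have r1t : r1 <= t by lra.
  have [E1 _] := solution_decay sol (decay_minorant0 M) ds h7 h5 (leq_addr n i) sM.
  exists r2; split=> //; first by rewrite addnS.
  rewrite addnS in h8 h3 h4.
  have : tau <= r2 - r1.
    apply: (gap r1 r2 _ h7 h8 h3 h4 h6 (le_trans E1 sM)).
    by apply: nA => //; [exact: leq_addr | rewrite ltnW// -addnS ltnW].
  by rewrite -natr1; lra.
have q0 : 0 <= (t - s) / tau by apply: divr_ge0; lra.
move: ij; rewrite leq_eqVlt => /predU1P[->|ij]; first by rewrite subrr; lra.
pose n := (j - i).-1.
have jE : j = (i + n.+1)%N by rewrite /n prednK ?subn_gt0// subnKC// ltnW.
have jn : (i + n.+1 <= j)%N by rewrite -jE.
have dn : dom (t, (i + n.+1)%N) by rewrite -jE.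
have [r' [_ r't _ _ nr]] := key n t jn dn st (lexx t).
have : n%:R <= (t - s) / tau by rewrite ler_pdivlMr//; lra.
by rewrite jE natrD -natr1; lra.
Qed.

(** * The two conclusions *)

Lemma energy_init_le Delta (q : ncs_state R nP nC nu) : 0 <= q_eta q ->
  @set_dist _ _ H A q < Delta -> energy q <= energy_up Delta.
Proof.
move=> eta0 dD; apply: le_trans (energy_le_dist eta0) _.
apply: (class_K_le energy_up_Koo.1) (ltW dD).
by rewrite set_dist_target enorm_ge0.
Qed.

Lemma ncs_dwell_time : semiglobal_dwell_time_outside A.
Proof.
move=> Delta D0.
have [tau tau0 gap] := successive_jumps_gap (class_K_gt0 energy_up_Koo.1 D0).
exists tau => // dom phi sol dD s i t j ds dt st ij nA.
have [d0 _] := sol_init sol.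
have E0 := energy_init_le (solution_eta_ge0 sol d0) dD.
have s0 : 0 <= s by have [h _] := sol_domain sol; exact: h ds.
have [Es _] := solution_decay sol (decay_minorant0 _) d0 ds s0 (leq0n i) E0.
apply: (solution_dwell_time sol tau0 _ ds dt st ij (le_trans Es E0) nA).
by move=> a b k da da1 db1 db2; exact: gap sol da da1 db1 db2.
Qed.

Lemma ncs_SGAS : SGAS A.
Proof.
split; first exact: closed_target.
move=> Delta D0; pose M := energy_up Delta.
have M0 : 0 < M by exact: class_K_gt0 energy_up_Koo.1 D0.
have [tau tau0 gap] := successive_jumps_gap M0.
have [|c [c0 c_gt0 c_lip c_le]] := lipschitz_minorant M0 _ decrease0
    (fun s s0 _ => decrease_gt0 s0).
  apply: continuous_subspaceW decrease_continuous => s.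
  by rewrite /= in_itv /= => /andP[].
have hc : decay_minorant c M.
  by split=> // [u|u v /c_lip[]//]; exact: (decay_rate_ge0 c0 c_lip).
(* Outside the target the dwell time gives [t >= tau * (j - 1)]. *)
pose T t j : R := (t + tau * Num.max (j - 1) 0) / 2.
have mx0 (x : R) : 0 <= Num.max x 0 by rewrite le_max lexx orbT.
have T0 t j : 0 <= t -> 0 <= T t j.
  by move=> t0; apply: divr_ge0 => //; apply: addr_ge0 => //;
    apply: mulr_ge0 => //; exact: ltW.
exists (fun s t j => dist_up (decay c (energy_up s) (T t j))).
  move=> x x0; split; apply: class_KL_decay => //; try exact: dist_up_Koo;
    try exact: energy_up_Koo.
  - apply: continuous_subspaceT => t; apply: cvgMl.
    by apply: cvgD; [exact: cvg_id|exact: cvg_cst].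
  - by move=> t t0; apply: T0.
  - by move=> t t' t0 tt'; rewrite /T; lra.
  - move=> K; exists (2 * (Num.max K 0) + 1).
      by have := mx0 K; lra.
    have := mulr_ge0 (ltW tau0) (mx0 (x - 1)).
    have : K <= Num.max K 0 by rewrite le_max lexx.
    by rewrite /T; lra.
  - apply: continuous_subspaceT => t; apply: cvgMl.
    apply: cvgD; first exact: cvg_cst.
    apply: cvgMr; apply: (@continuous_max _ _ (fun j : R => j - 1) (fun=> 0)).
      by apply: cvgB; [exact: cvg_id|exact: cvg_cst].
    exact: cvg_cst.
  - by move=> t _; exact: T0.
  - move=> t t' t0 tt'; rewrite /T ler_pM2r; last lra.
    rewrite lerD2l ler_pM2l// ge_max !le_max lexx orbT andbT.
    by apply/orP; left; lra.
  - move=> K; exists (2 * Num.max K 0 / tau + 2).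
      apply: addr_ge0 => //; apply: divr_ge0; last exact: ltW.
      by have := mx0 K; lra.
    rewrite /T max_l; last first.
      have : 0 <= 2 * Num.max K 0 / tau by apply: divr_ge0; [have := mx0 K;
        lra|exact: ltW].
      by lra.
    have -> : tau * (2 * Num.max K 0 / tau + 2 - 1) = 2 * Num.max K 0 + tau.
      by field; lra.
    have : K <= Num.max K 0 by rewrite le_max lexx.
    by lra.
move=> dom phi sol dD t j dt.
have [d0 _] := sol_init sol.
have eta0 := solution_eta_ge0 sol d0.
have E0 : energy (phi 0 0%N) <= M := energy_init_le eta0 dD.
have t0 : 0 <= t by have [h _] := sol_domain sol; exact: h dt.
have [_ Et] := solution_decay sol hc d0 dt t0 (leq0n j) E0.
set d := set_dist _ (phi 0 0%N).
have d_ge0 : 0 <= d by rewrite /d set_dist_target enorm_ge0.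
have u0 := class_K_ge0 energy_up_Koo.1 d_ge0.
have et0 := energy_ge0 (phi t j).
apply: le_trans (dist_le_energy (solution_eta_ge0 sol dt)) _.
apply: (class_K_le dist_up_Koo.1) => //.
apply: (decay_ge c0 c_lip) => //; first exact: T0.
apply: le_trans (energy_le_dist eta0); apply: le_trans Et.
rewrite subr0 lerD2l.
have cE0 := decay_rate_ge0 c0 c_lip et0.
have [->|En0] := eqVneq (energy (phi t j)) 0; first by rewrite c0 !mulr0.
apply: ler_wpM2r => //.
(* Then [T t j], the mean of [t] and a smaller number, is at most [t]. *)
suff : tau * Num.max (j%:R - 1) 0 <= t by rewrite /T; lra.
have [j1|j1] := lerP (j%:R - 1 : R) 0; first by rewrite mulr0.
have : j%:R - 0%:R <= (t - 0) / tau + 1.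
  apply: (solution_dwell_time sol tau0 _ d0 dt t0 (leq0n j) E0).
    by move=> a b k da da1 db1 db2; exact: gap sol da da1 db1 db2.
  (* A visit to the target would leave the energy at 0 from then on, contrary to [En0]. *)
  move=> t' j' dt' /andP[t'0 t't] /andP[_ j'j] /energy_target E'.
  have [Et' _] := solution_decay sol (decay_minorant0 M) d0 dt' t'0 (leq0n j') E0.
  have [Ett' _] := solution_decay sol (decay_minorant0 M) dt' dt t't j'j
    (le_trans Et' E0).
  by move/eqP: En0; apply; apply/le_anti; rewrite et0 andbT -E'.
rewrite !subr0 -lerBlDr ler_pdivlMr// => h.
by rewrite mulrC.
Qed.

End NCSStability.

Theorem theorem2 (R : realType) (nP nC nu : nat) (S : ncs R nP nC nu)
  (delta alphaV_lo alphaV_up alpha gamma alphaW_lo alphaW_up sigma gtilde : R -> R)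
  (V : 'rV[R]_(nP + nC) -> R) (W : R -> 'rV[R]_(nP + nu) -> R) (rho : R)
  (hgC : partially_differentiable_gC S)
  (hfx : continuous
     (fun z : 'rV[R]_(nP + nC) * 'rV[R]_(nP + nu) => fx S z.1 z.2))
  (hfe : continuous
     (fun z : 'rV[R]_(nP + nC) * 'rV[R]_(nP + nu) => fe S z.1 z.2))
  (hdelta : class_Koo delta)
  (hdelta_lip : locally_lipschitz_on nonneg delta)
  (* closedness of C and D, and continuity of the flow and jump maps of eta *)
  (hC : closed (@ncs_coords R nP nC nu @` ncs_flow_set gtilde V W))
  (hD : closed (@ncs_coords R nP nC nu @` ncs_jump_set gtilde V W))
  (heta_flow : {within nonneg, continuous (fun eta : R => - delta eta)})
  (heta_jump : continuous
     (fun z : nat * 'rV[R]_(nP + nu) => gtildeW gtilde W z.1 z.2))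
  (* input-to-state stability *)
  (hV_smooth : smooth V)
  (halphaV_lo : class_Koo alphaV_lo) (halphaV_up : class_Koo alphaV_up)
  (halpha : class_Koo alpha) (hgamma : class_Koo gamma)
  (hV_bounds : forall x, alphaV_lo (enorm x) <= V x <= alphaV_up (enorm x))
  (hV_decr : forall x e,
     dot (grad V x) (fx S x e) <= - alpha (V x) + gamma (enorm e))
  (* UGAS protocol *)
  (hW_ge0 : forall (k : R) e, 0 <= k -> 0 <= W k e)
  (halphaW_lo : class_Koo alphaW_lo) (halphaW_up : class_Koo alphaW_up)
  (hrho : 0 <= rho < 1)
  (hW_bounds : forall (k : nat) e,
     alphaW_lo (enorm e) <= W k%:R e <= alphaW_up (enorm e))
  (hW_jump : forall (k : nat) e, W k.+1%:R (he S k e) <= rho * W k%:R e)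
  (hsigma : class_Koo sigma) (hsigma_lt : forall s : R, 0 < s -> sigma s < s)
  (hgtilde : forall s : R, 0 <= s ->
     gtilde s = inv_nonneg alpha (inv_nonneg sigma (gamma (inv_nonneg alphaW_lo s))))
  (hgtildeW_lip : forall k : nat,
     locally_lipschitz_on setT (gtildeW gtilde W k))
  (hgrowth : forall K : set ('rV[R]_(nP + nC) * 'rV[R]_(nP + nu)), compact K ->
     exists L1 L2 : R, [/\ 0 <= L1, 0 <= L2 &
       forall x e, K (x, e) -> forall k : nat,
         `|dot (grad V x) (fx S x e)| <= L1 * (V x + gtildeW gtilde W k e) /\
         (`|clarke (gtildeW gtilde W k) e (fe S x e)|
            <= (L2 * (V x + gtildeW gtilde W k e))%:E)%E])
  (hratio : exists2 eps : R, 0 <= eps < 1 &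
     gtilde (rho * s) / gtilde s @[s --> 0^'+] --> eps) :
  SGAS (target S delta gtilde V W) /\
  semiglobal_dwell_time_outside (target S delta gtilde V W).
Proof.
have hV x : differentiable V x by exact: (hV_smooth [::] x).
have hL K : compact K -> exists2 L : R, 0 <= L & forall x e, K (x, e) ->
    forall k : nat, (clarke (gtildeW gtilde W k) e (fe S x e)
      <= (L * (V x + gtildeW gtilde W k e))%:E)%E.
  move=> /hgrowth[L1 [L [_ L0 hL]]]; exists L => // x e Kxe k.
  by have [_] := hL x e Kxe k; apply: le_trans; exact: lee_abs.
split.
  by apply: (@ncs_SGAS _ _ _ _ S delta alphaV_lo alphaV_up alpha gamma alphaW_lo
    alphaW_up sigma gtilde V W rho).
by apply: (@ncs_dwell_time _ _ _ _ S delta alphaV_lo alphaV_up alpha gamma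
  alphaW_lo alphaW_up sigma gtilde V W rho).
Qed.
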